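(* Let $p\in\mathcal{H}$ with $p(0)=1$, let $\varphi_{\mathrm{cr}}(z):=z+\sqrt{1+z^2}$ for $z\in\mathbb{D}$, let $\varphi_{Ne}(z):=1+z-z^3/3$, and let $\beta\in\mathbb{R}$. If any of the following differential subordinations holds, then $p\prec\varphi_{Ne}$: (a) $1+\beta zp'(z)\prec\varphi_{\mathrm{cr}}(z)$, for $\beta\geq\dfrac{3\left(\sqrt{2}-\log(1+\sqrt{2})+\log2\right)}{2}\approx1.83898$; (b) $1+\beta\,\dfrac{zp'(z)}{p(z)}\prec\varphi_{\mathrm{cr}}(z)$, for $\beta\geq\dfrac{\sqrt{2}+\log2-\log(1+\sqrt{2})}{\log(5/3)}\approx2.40001$; (c) $1+\beta\,\dfrac{zp'(z)}{p^2(z)}\prec\varphi_{\mathrm{cr}}(z)$, for $\beta\geq\dfrac{5\left(\sqrt{2}-\log(1+\sqrt{2})+\log2\right)}{2}\approx3.06497$. Each estimate is sharp.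
   Context: $\mathbb{D}=\{z\in\mathbb{C}:|z|<1\}$ and $\mathcal{H}$ is the set of all analytic functions on $\mathbb{D}$. For $f,g\in\mathcal{H}$, $f\prec g$ ($f$ is subordinate to $g$) means that there is $w\in\mathcal{H}$ with $w(0)=0$ and $|w(z)|<1$ for $z\in\mathbb{D}$ such that $f(z)=g(w(z))$ on $\mathbb{D}$; in particular, writing a subordination presupposes that both sides are analytic in $\mathbb{D}$. The square root is the principal branch (so $\varphi_{\mathrm{cr}}(0)=1$) and $\log$ of a positive number is the natural logarithm. That an estimate $\beta\ge\beta_0$ is sharp means that $\beta_0$ cannot be replaced by any smaller real number so that the implication remains valid for all such $p$ and all $\beta$ at least that number. *)

(* Defs.v *)
From Stdlib Require Import Reals Lra.
From Coquelicot Require Import Coquelicot.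

Open Scope R_scope.

Definition in_disk (z : C) : Prop := Cmod z < 1.

(* Functions on the disk are represented by total functions [C -> C]; their
   values outside the disk are irrelevant.  Analytic means complex
   differentiable at every point of the (open) disk. *)
Definition analytic_in_disk (f : C -> C) : Prop :=
  forall z : C, in_disk z -> ex_derive (K := C_AbsRing) (V := C_NormedModule) f z.

(* The analyticity of [f] and [g] is part of subordination.  It matters for
   quotients: [/ 0 = 0] in [C], so at a zero of [p] the functions [Psi_b] and
   [Psi_c] below have a junk value, but near it they are unbounded (if
   [beta <> 0]), hence not analytic. *)
Definition subordinate (f g : C -> C) : Prop :=
  analytic_in_disk f /\ analytic_in_disk g /\
  exists w : C -> C,
    analytic_in_disk w /\ w 0 = 0 /\
    (forall z : C, in_disk z -> Cmod (w z) < 1) /\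
    (forall z : C, in_disk z -> f z = g (w z)).

(* Principal square root: with [x = Re z], [y = Im z],
   [sqrt ((|z| + x) / 2) + i * sign y * sqrt ((|z| - x) / 2)],
   the sign being [1] for [y = 0]. *)
Definition Csqrt (z : C) : C :=
  (sqrt ((Cmod z + Re z) / 2),
   if Rlt_dec (Im z) 0 then - sqrt ((Cmod z - Re z) / 2)
   else sqrt ((Cmod z - Re z) / 2)).

Lemma Csqrt_sqr (z : C) : (Csqrt z * Csqrt z)%C = z.
Proof.
destruct z as [x y]; unfold Csqrt; simpl Re; simpl Im.
assert (H2 : Cmod (x, y) * Cmod (x, y) = x * x + y * y).
{ unfold Cmod; simpl fst; simpl snd; rewrite sqrt_sqrt; nra. }
assert (H0 := Cmod_ge_0 (x, y)).
set (r := Cmod (x, y)) in *.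
assert (Hp : 0 <= (r + x) / 2) by nra.
assert (Hm : 0 <= (r - x) / 2) by nra.
assert (Hs : sqrt ((r + x) / 2) * sqrt ((r - x) / 2) = Rabs y / 2).
{ rewrite <- sqrt_mult by assumption.
  replace ((r + x) / 2 * ((r - x) / 2)) with (Rsqr (Rabs y / 2)).
  - apply sqrt_Rsqr; assert (Hy := Rabs_pos y); lra.
  - assert (Hy := Rsqr_abs y); unfold Rsqr in *; nra. }
assert (Hpp := sqrt_sqrt _ Hp); assert (Hmm := sqrt_sqrt _ Hm).
unfold Cmult; simpl fst; simpl snd.
destruct (Rlt_dec y 0) as [Hy | Hy].
- rewrite Rabs_left in Hs by assumption; f_equal; nra.
- rewrite Rabs_right in Hs by lra; f_equal; nra.
Qed.

Lemma Csqrt_Re_ge_0 (z : C) : 0 <= Re (Csqrt z).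
Proof. apply sqrt_pos. Qed.

Definition phi_cr (z : C) : C := (z + Csqrt (1 + z ^ 2))%C.

Definition phi_Ne (z : C) : C := (1 + z - z ^ 3 / 3)%C.

Definition Psi_a (p : C -> C) (beta : R) (z : C) : C :=
  (1 + beta * (z * C_derive p z))%C.

Definition Psi_b (p : C -> C) (beta : R) (z : C) : C :=
  (1 + beta * (z * C_derive p z / p z))%C.

Definition Psi_c (p : C -> C) (beta : R) (z : C) : C :=
  (1 + beta * (z * C_derive p z / p z ^ 2))%C.

Definition beta_a : R := 3 * (sqrt 2 - ln (1 + sqrt 2) + ln 2) / 2.

Definition beta_b : R := (sqrt 2 + ln 2 - ln (1 + sqrt 2)) / ln (5 / 3).

Definition beta_c : R := 5 * (sqrt 2 - ln (1 + sqrt 2) + ln 2) / 2.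

Definition sharp (Psi : (C -> C) -> R -> C -> C) (beta0 : R) : Prop :=
  forall b : R, b < beta0 ->
  ~ (forall (p : C -> C) (beta : R),
       analytic_in_disk p -> p 0 = 1 -> b <= beta ->
       subordinate (Psi p beta) phi_cr -> subordinate p phi_Ne).

(* Main.v *)
Require Import Defs.
From Stdlib Require Import Reals Lra Classical ClassicalEpsilon.
From Coquelicot Require Import Coquelicot.
Open Scope R_scope.

(* Write the given subordination as [Psi p z = phi_cr (w z)].  By the Schwarz
   lemma [|w z| <= |z|], and [|phi_cr w - 1| <= r + sqrt (1 + r^2) - 1 = r F'(r)]
   for [|w| <= r], where [F] is the primitive [cr_primitive], whose value at [1]
   is [L = sqrt 2 - ln (1 + sqrt 2) + ln 2].  Integrating along rays from [0]
   bounds [|p - 1|] by [x], [exp x - 1] and [x / (1 - x)] respectively, with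
   [x = F(|z|) / beta < L / beta]; the thresholds for [beta] make all three bounds
   at most [2/3].  As [|z - z^3/3| >= 2/3] on the unit circle, [phi_Ne] maps a
   part of the disk conformally onto the disk of centre [1] and radius [2/3], so
   [p] is subordinate to [phi_Ne].  Sharpness: for [w z = z] the three bounds are
   attained at positive [z], and [phi_Ne] takes no real value [>= 5/3]. *)

(** * Complex derivatives *)

(** Analyticity here is mere differentiability, with no continuity of the derivative. Hence the
    Schwarz lemma starts from Goursat's theorem, proved by bisection, and its quotient [w z / z] is
    at first only known to be continuous at [0]; the maximum principle is built to tolerate that
    point. For the same reason [C_derive p] is never literally integrated along a ray: [|p - 1|] is
    compared with the solution of a differential equation, and a first crossing is excluded by the
    derivatives at that single point. The comparison also copes with possible zeros of [p] in (b)
    and (c): at a crossing [|p - 1| <= 2/3] keeps [p] away from [0].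

    The estimate of [phi_cr] depends on the principal branch, which gives [phi_cr w] a nonnegative
    real part. The number [2/3] is [phi_Ne 1 - 1]: the disk around [1] touches the boundary of the
    image of [phi_Ne] at [5/3], the value that the extremal functions reach below the thresholds. *)

Definition Ccont (f : C -> C) (z : C) : Prop :=
  forall eps, 0 < eps -> exists del, 0 < del /\
    forall y, Cmod (y - z) < del -> Cmod (f y - f z) < eps.

Definition Cder (f : C -> C) (z d : C) : Prop :=
  forall eps, 0 < eps -> exists del, 0 < del /\
    forall y, Cmod (y - z) < del ->
      Cmod (f y - f z - d * (y - z)) <= eps * Cmod (y - z).

Lemma Cmod_triangle_minus (x y : C) : Cmod (x - y) <= Cmod x + Cmod y.
Proof. unfold Cminus; rewrite <- (Cmod_opp y); apply Cmod_triangle. Qed.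

Lemma Cmod_minus_sym (x y : C) : Cmod (x - y) = Cmod (y - x).
Proof. rewrite <- Cmod_opp; f_equal; ring. Qed.

Lemma Cmod_triangle_rev (x y : C) : Cmod x - Cmod y <= Cmod (x - y).
Proof.
  assert (H := Cmod_triangle (x - y) y).
  replace (x - y + y)%C with x in H by ring. lra.
Qed.

Lemma Cmod_sqr (z : C) : Cmod z * Cmod z = Re z * Re z + Im z * Im z.
Proof.
  unfold Cmod, Re, Im; rewrite sqrt_sqrt; [ring|].
  assert (H := pow2_ge_0 (fst z)); assert (H' := pow2_ge_0 (snd z)); lra.
Qed.

Lemma Re_le_Cmod (z : C) : Re z <= Cmod z.
Proof. assert (H := re_le_Cmod z); assert (H' := Rle_abs (Re z)); lra. Qed.

Lemma Im_le_Cmod (z : C) : Rabs (Im z) <= Cmod z.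
Proof. eapply Rle_trans; [apply Rmax_r | apply Rmax_Cmod]. Qed.

Lemma Ccont_const (c z : C) : Ccont (fun _ => c) z.
Proof.
  intros eps He; exists 1; split; [lra|]; intros y _.
  replace (c - c)%C with (RtoC 0) by ring; rewrite Cmod_0; lra.
Qed.

Lemma Ccont_id (z : C) : Ccont (fun x => x) z.
Proof. intros eps He; exists eps; auto. Qed.

Lemma Ccont_plus (f g : C -> C) (z : C) :
  Ccont f z -> Ccont g z -> Ccont (fun x => f x + g x)%C z.
Proof.
  intros Hf Hg eps He.
  destruct (Hf (eps / 2)) as [d1 [Hd1 H1]]; [lra|].
  destruct (Hg (eps / 2)) as [d2 [Hd2 H2]]; [lra|].
  exists (Rmin d1 d2); split; [now apply Rmin_pos|]; intros y Hy.
  assert (Hy1 := Rlt_le_trans _ _ _ Hy (Rmin_l d1 d2)).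
  assert (Hy2 := Rlt_le_trans _ _ _ Hy (Rmin_r d1 d2)).
  specialize (H1 y Hy1); specialize (H2 y Hy2).
  replace (f y + g y - (f z + g z))%C with ((f y - f z) + (g y - g z))%C by ring.
  assert (H := Cmod_triangle (f y - f z) (g y - g z)); lra.
Qed.

Lemma Ccont_mult (f g : C -> C) (z : C) :
  Ccont f z -> Ccont g z -> Ccont (fun x => f x * g x)%C z.
Proof.
  intros Hf Hg eps He.
  set (A := Cmod (f z) + Cmod (g z) + 1).
  assert (HA : 1 <= A) by (unfold A; assert (Ha := Cmod_ge_0 (f z)); assert (Hb := Cmod_ge_0 (g z)); lra).
  assert (He' : 0 < Rmin 1 (eps / (2 * A))).
  { apply Rmin_pos; [lra|]; apply Rdiv_lt_0_compat; lra. }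
  destruct (Hf _ He') as [d1 [Hd1 H1]].
  destruct (Hg _ He') as [d2 [Hd2 H2]].
  exists (Rmin d1 d2); split; [now apply Rmin_pos|]; intros y Hy.
  specialize (H1 y (Rlt_le_trans _ _ _ Hy (Rmin_l d1 d2))).
  specialize (H2 y (Rlt_le_trans _ _ _ Hy (Rmin_r d1 d2))).
  replace (f y * g y - f z * g z)%C
    with ((f y - f z) * (g y - g z) + (f z * (g y - g z) + g z * (f y - f z)))%C by ring.
  assert (Hm1 := Rmin_l 1 (eps / (2 * A))); assert (Hm2 := Rmin_r 1 (eps / (2 * A))).
  set (m := Rmin 1 (eps / (2 * A))) in *.
  assert (HmA : m * A <= eps / 2).
  { replace (eps / 2) with (eps / (2 * A) * A) by (field; lra).
    apply Rmult_le_compat_r; lra. }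
  eapply Rle_lt_trans; [apply Cmod_triangle|].
  assert (H := Cmod_triangle (f z * (g y - g z)) (g z * (f y - f z))).
  rewrite !Cmod_mult in *.
  assert (Ha := Cmod_ge_0 (f z)); assert (Hb := Cmod_ge_0 (g z)).
  assert (Hc := Cmod_ge_0 (f y - f z)); assert (Hd := Cmod_ge_0 (g y - g z)).
  unfold A in HmA. nra.
Qed.

Lemma Ccont_comp (f g : C -> C) (z : C) :
  Ccont g z -> Ccont f (g z) -> Ccont (fun x => f (g x)) z.
Proof.
  intros Hg Hf eps He.
  destruct (Hf eps He) as [d1 [Hd1 H1]]; destruct (Hg d1 Hd1) as [d2 [Hd2 H2]].
  exists d2; split; auto.
Qed.

Lemma Ccont_inv (z : C) : z <> 0 -> Ccont Cinv z.
Proof.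
  intros Hz eps He.
  assert (Hm : 0 < Cmod z) by now apply Cmod_gt_0.
  set (m := Cmod z) in *.
  assert (Hp : 0 < eps * (m * m) / 2) by (apply Rdiv_lt_0_compat; [|lra]; repeat apply Rmult_lt_0_compat; auto).
  exists (Rmin (m / 2) (eps * (m * m) / 2)); split; [apply Rmin_pos; lra|].
  intros y Hy.
  assert (Hy1 := Rlt_le_trans _ _ _ Hy (Rmin_l _ _)).
  assert (Hy2 := Rlt_le_trans _ _ _ Hy (Rmin_r _ _)).
  assert (Hym : m / 2 < Cmod y).
  { assert (H := Cmod_triangle_rev z y); rewrite Cmod_minus_sym in H; unfold m in *; lra. }
  assert (Hy0 : y <> 0) by (apply Cmod_gt_0; lra).
  replace (/ y - / z)%C with ((z - y) / (y * z))%C by (field; auto).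
  rewrite Cmod_div by now apply Cmult_neq_0.
  rewrite Cmod_mult, Cmod_minus_sym; fold m.
  apply (Rmult_lt_reg_r (Cmod y * m)); [apply Rmult_lt_0_compat; lra|].
  unfold Rdiv; rewrite Rmult_assoc, Rinv_l by (apply Rgt_not_eq, Rmult_lt_0_compat; lra).
  assert (eps * (m * m) / 2 <= eps * (Cmod y * m)).
  { replace (eps * (m * m) / 2) with (eps * (m / 2 * m)) by field.
    apply Rmult_le_compat_l; [lra|]; apply Rmult_le_compat_r; lra. }
  lra.
Qed.

Lemma Ccont_ext_loc (f g : C -> C) (z : C) (r : R) :
  0 < r -> (forall y, Cmod (y - z) < r -> f y = g y) -> Ccont f z -> Ccont g z.
Proof.
  intros Hr Hfg Hf eps He; destruct (Hf eps He) as [d [Hd H]].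
  exists (Rmin d r); split; [now apply Rmin_pos|]; intros y Hy.
  assert (Hy1 := Rlt_le_trans _ _ _ Hy (Rmin_l _ _)).
  assert (Hy2 := Rlt_le_trans _ _ _ Hy (Rmin_r _ _)).
  rewrite <- !Hfg; auto.
  replace (z - z)%C with (RtoC 0) by ring; rewrite Cmod_0; lra.
Qed.

(* Caratheodory's form of differentiability, which reduces the rules for
   derivatives to those for continuity. *)
Lemma Cder_slope (f : C -> C) (z d : C) :
  Cder f z d ->
  exists phi, Ccont phi z /\ phi z = d /\ forall y, f y = (f z + phi y * (y - z))%C.
Proof.
  intros Hf.
  exists (fun y => if Ceq_dec y z then d else ((f y - f z) / (y - z))%C).
  split; [|split].
  - intros eps He; destruct (Hf (eps / 2)) as [del [Hdel H]]; [lra|].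
    exists del; split; auto; intros y Hy.
    destruct (Ceq_dec z z) as [_|]; [|tauto].
    destruct (Ceq_dec y z) as [->|Hyz].
    + replace (d - d)%C with (RtoC 0) by ring; rewrite Cmod_0; lra.
    + assert (Hne : (y - z)%C <> 0) by now apply Cminus_eq_contra.
      assert (Hp : 0 < Cmod (y - z)) by now apply Cmod_gt_0.
      replace ((f y - f z) / (y - z) - d)%C with ((f y - f z - d * (y - z)) / (y - z))%C by (field; auto).
      rewrite Cmod_div by auto.
      apply Rle_lt_trans with (eps / 2); [|lra].
      apply Rle_div_l; [lra|]; auto.
  - destruct (Ceq_dec z z); tauto.
  - intros y; destruct (Ceq_dec y z) as [->|Hyz]; [ring|].
    field; now apply Cminus_eq_contra.
Qed.

Lemma slope_Cder (f phi : C -> C) (z : C) :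
  Ccont phi z -> (forall y, f y = (f z + phi y * (y - z))%C) -> Cder f z (phi z).
Proof.
  intros Hc Hf eps He; destruct (Hc eps He) as [del [Hdel H]].
  exists del; split; auto; intros y Hy.
  rewrite (Hf y); replace (f z + phi y * (y - z) - f z - phi z * (y - z))%C
    with ((phi y - phi z) * (y - z))%C by ring.
  rewrite Cmod_mult; apply Rmult_le_compat_r; [apply Cmod_ge_0|]; left; auto.
Qed.

Lemma Cder_Ccont (f : C -> C) (z d : C) : Cder f z d -> Ccont f z.
Proof.
  intros Hf; destruct (Cder_slope _ _ _ Hf) as [phi [Hc [_ Hphi]]].
  apply (Ccont_ext_loc (fun y => f z + phi y * (y + - z))%C _ _ 1); [lra| |].
  - intros y _; rewrite (Hphi y); ring.
  - apply Ccont_plus; [apply Ccont_const|]; apply Ccont_mult; auto.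
    apply Ccont_plus; [apply Ccont_id|apply Ccont_const].
Qed.

Lemma Cder_eq (f : C -> C) (z d d' : C) : d = d' -> Cder f z d -> Cder f z d'.
Proof. now intros ->. Qed.

Lemma Cder_const (c z : C) : Cder (fun _ => c) z 0.
Proof.
  apply (slope_Cder _ (fun _ => RtoC 0)); [apply Ccont_const|intros y; ring].
Qed.

Lemma Cder_id (z : C) : Cder (fun x => x) z 1.
Proof.
  apply (slope_Cder _ (fun _ => RtoC 1)); [apply Ccont_const|intros y; ring].
Qed.

Lemma Cder_plus (f g : C -> C) (z df dg : C) :
  Cder f z df -> Cder g z dg -> Cder (fun x => f x + g x)%C z (df + dg).
Proof.
  intros Hf Hg.
  destruct (Cder_slope _ _ _ Hf) as [phi [Hc [<- Hphi]]].
  destruct (Cder_slope _ _ _ Hg) as [psi [Hc' [<- Hpsi]]].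
  apply (slope_Cder _ (fun y => phi y + psi y)%C); [now apply Ccont_plus|].
  intros y; rewrite (Hphi y), (Hpsi y); ring.
Qed.

Lemma Cder_mult (f g : C -> C) (z df dg : C) :
  Cder f z df -> Cder g z dg ->
  Cder (fun x => f x * g x)%C z (df * g z + f z * dg).
Proof.
  intros Hf Hg; assert (Hcg := Cder_Ccont _ _ _ Hg).
  destruct (Cder_slope _ _ _ Hf) as [phi [Hc [<- Hphi]]].
  destruct (Cder_slope _ _ _ Hg) as [psi [Hc' [<- Hpsi]]].
  apply (slope_Cder _ (fun y => phi y * g y + f z * psi y)%C).
  - apply Ccont_plus; apply Ccont_mult; auto; apply Ccont_const.
  - intros y; rewrite (Hphi y), (Hpsi y); ring.
Qed.

Lemma Cder_scal (f : C -> C) (c z d : C) :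
  Cder f z d -> Cder (fun x => c * f x)%C z (c * d).
Proof.
  intros Hf; replace (c * d)%C with (0 * f z + c * d)%C by ring.
  apply (Cder_mult (fun _ => c)); [apply Cder_const|auto].
Qed.

Lemma Cder_comp (f g : C -> C) (z df dg : C) :
  Cder f (g z) df -> Cder g z dg -> Cder (fun x => f (g x)) z (df * dg).
Proof.
  intros Hf Hg; assert (Hcg := Cder_Ccont _ _ _ Hg).
  destruct (Cder_slope _ _ _ Hf) as [phi [Hc [<- Hphi]]].
  destruct (Cder_slope _ _ _ Hg) as [psi [Hc' [<- Hpsi]]].
  apply (slope_Cder _ (fun y => phi (g y) * psi y)%C).
  - apply Ccont_mult; auto; now apply Ccont_comp.
  - intros y; rewrite (Hphi (g y)), (Hpsi y) at 1.
    rewrite (Hpsi y); ring.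
Qed.

Lemma Cder_ext_loc (f g : C -> C) (z d : C) (r : R) :
  0 < r -> (forall y, Cmod (y - z) < r -> f y = g y) -> Cder f z d -> Cder g z d.
Proof.
  intros Hr Hfg Hf eps He; destruct (Hf eps He) as [del [Hd H]].
  exists (Rmin del r); split; [now apply Rmin_pos|]; intros y Hy.
  assert (Hy1 := Rlt_le_trans _ _ _ Hy (Rmin_l _ _)).
  assert (Hy2 := Rlt_le_trans _ _ _ Hy (Rmin_r _ _)).
  rewrite <- !Hfg; auto.
  replace (z - z)%C with (RtoC 0) by ring; rewrite Cmod_0; lra.
Qed.

(* Only continuity of the local right inverse [g] is required. *)
Lemma Cder_inverse (f g : C -> C) (z d : C) (r : R) :
  0 < r -> (forall y, Cmod (y - z) < r -> f (g y) = y) ->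
  Ccont g z -> Cder f (g z) d -> d <> 0 -> Cder g z (/ d).
Proof.
  intros Hr Hfg Hg Hf Hd.
  destruct (Cder_slope _ _ _ Hf) as [phi [Hc [<- Hphi]]].
  assert (Hpg : Ccont (fun y => phi (g y)) z) by now apply Ccont_comp.
  destruct (Hpg (Cmod (phi (g z)))) as [del [Hdel H]]; [now apply Cmod_gt_0|].
  assert (Hz : Cmod (z - z) < r).
  { replace (z - z)%C with (RtoC 0) by ring; rewrite Cmod_0; lra. }
  (* [slope_Cder] wants the slope identity at every [y], but [f (g y) = y] is known only near [z].
     Farther away [g] is replaced by the value that makes the identity true by construction. *)
  apply (Cder_ext_loc (fun y => if Rlt_dec (Cmod (y - z)) (Rmin del r) then g y
    else (g z + / phi (g y) * (y - z))%C) _ _ _ (Rmin del r)); [now apply Rmin_pos| |].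
  { intros y Hy; destruct (Rlt_dec (Cmod (y - z)) (Rmin del r)); tauto. }
  apply (slope_Cder _ (fun y => / phi (g y))%C).
  - now apply (Ccont_comp Cinv); [|apply Ccont_inv].
  - intros y.
    destruct (Rlt_dec (Cmod (z - z)) (Rmin del r)) as [_|Hn].
    2:{ exfalso; apply Hn; replace (z - z)%C with (RtoC 0) by ring; rewrite Cmod_0; now apply Rmin_pos. }
    destruct (Rlt_dec (Cmod (y - z)) (Rmin del r)) as [Hy|_]; [|ring].
    assert (Hy1 := Rlt_le_trans _ _ _ Hy (Rmin_l _ _)).
    assert (Hy2 := Rlt_le_trans _ _ _ Hy (Rmin_r _ _)).
    assert (Hne : phi (g y) <> 0).
    { intros E; specialize (H y Hy1); cbv beta in H; rewrite E in H.
      replace (0 - phi (g z))%C with (- phi (g z))%C in H by ring.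
      rewrite Cmod_opp in H; lra. }
    assert (E := Hphi (g y)); rewrite !Hfg in E by auto.
    assert (E' : (y - z = phi (g y) * (g y - g z))%C) by (rewrite E at 1; ring).
    rewrite E'; field; auto.
Qed.

Lemma Cder_inv (z : C) : z <> 0 -> Cder Cinv z (- / (z * z)).
Proof.
  intros Hz.
  (* For [y <> 0] this formula equals [/ y] exactly; the radius [|z|] excludes [y = 0]. *)
  apply (Cder_ext_loc (fun y => / z + (- / (z * y)) * (y - z))%C _ _ _ (Cmod z)).
  - now apply Cmod_gt_0.
  - intros y Hy.
    assert (Hy0 : y <> 0).
    { intros ->; replace (0 - z)%C with (- z)%C in Hy by ring.
      rewrite Cmod_opp in Hy; lra. }
    field; auto.
  - apply (slope_Cder _ (fun y => - / (z * y))%C).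
    + apply (Ccont_ext_loc (fun y => - (1) * / (z * y))%C _ _ 1); [lra|intros; ring|].
      apply Ccont_mult; [apply Ccont_const|].
      apply (Ccont_comp Cinv); [|apply Ccont_inv; now apply Cmult_neq_0].
      apply Ccont_mult; [apply Ccont_const|apply Ccont_id].
    + intros y; ring.
Qed.

Lemma is_derive_Cder (f : C -> C) (z d : C) :
  is_derive (K := C_AbsRing) (V := C_NormedModule) f z d <-> Cder f z d.
Proof.
  assert (E : forall y, (f y - f z - d * (y - z))%C
    = minus (minus (f y) (f z)) (scal (minus y z) d)).
  { intros y; unfold scal, minus; simpl; unfold mult, plus, opp; simpl; ring. }
  split.
  - intros [_ H] eps He.
    destruct (H z (fun P HP => HP) (mkposreal eps He)) as [del Hdel].
    exists del; split; [apply cond_pos|]; intros y Hy.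
    rewrite E; exact (Hdel y Hy).
  - intros H; split; [apply is_linear_scal_l|].
    intros x Hx eps.
    apply (is_filter_lim_locally_unique (V := AbsRing_NormedModule C_AbsRing)) in Hx.
    subst x.
    destruct (H eps (cond_pos eps)) as [del [Hdel H']].
    exists (mkposreal del Hdel); intros y Hy.
    specialize (H' y Hy); rewrite E in H'; exact H'.
Qed.

Lemma Cder_C_derive (f : C -> C) (z d : C) : Cder f z d -> C_derive f z = d.
Proof. intros H; now apply is_C_derive_unique, is_derive_Cder. Qed.

Lemma analytic_Cder (f : C -> C) :
  analytic_in_disk f <-> forall z, in_disk z -> exists d, Cder f z d.
Proof.
  split; intros H z Hz; destruct (H z Hz) as [d Hd]; exists d; now apply is_derive_Cder.
Qed.

(** * Bisection of rectangles *)

Lemma nested_intervals_point (a b : nat -> R) :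
  (forall n, a n <= a (S n)) -> (forall n, b (S n) <= b n) ->
  (forall n, a n <= b n) -> exists x, forall n, a n <= x <= b n.
Proof.
  intros Ha Hb Hab.
  assert (Ha' : forall n k, a n <= a (n + k)%nat).
  { intros n; induction k as [|k IH]; [rewrite Nat.add_0_r; lra|].
    rewrite Nat.add_succ_r; specialize (Ha (n + k)%nat); lra. }
  assert (Hb' : forall n k, b (n + k)%nat <= b n).
  { intros n; induction k as [|k IH]; [rewrite Nat.add_0_r; lra|].
    rewrite Nat.add_succ_r; specialize (Hb (n + k)%nat); lra. }
  assert (H : forall m n, a m <= b n).
  { intros m n; assert (H1 := Ha' m n); assert (H2 := Hb' n m).
    rewrite Nat.add_comm in H2; specialize (Hab (m + n)%nat); lra. }
  destruct (completeness (fun r => exists n, r = a n)) as [x [Hx1 Hx2]].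
  - exists (b 0%nat); intros r [n ->]; auto.
  - exists (a 0%nat), 0%nat; auto.
  - exists x; intros n; split; [apply Hx1; now exists n|].
    apply Hx2; intros r [m ->]; auto.
Qed.

(** The test is classical, as [P] is not decidable. The last quarter is taken untested: if some
    quarter satisfies [P] and the other three fail, it is this one. *)
Definition quarter (P : R -> R -> R -> R -> Prop) (q : R * R * R * R) : R * R * R * R :=
  let '(a, b, c, d) := q in
  let m := (a + b) / 2 in let n := (c + d) / 2 in
  if excluded_middle_informative (P a m c n) then (a, m, c, n)
  else if excluded_middle_informative (P m b c n) then (m, b, c, n)
  else if excluded_middle_informative (P a m n d) then (a, m, n, d)
  else (m, b, n, d).

(** The common compactness tool for maxima on disks and for Goursat's theorem: a property that
    always passes to some quarter survives in arbitrarily small rectangles around one point. *)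
Lemma rectangle_bisection (P : R -> R -> R -> R -> Prop) (a b c d : R) :
  a <= b -> c <= d -> P a b c d ->
  (forall a' b' c' d', a <= a' -> a' <= b' -> b' <= b ->
     c <= c' -> c' <= d' -> d' <= d -> P a' b' c' d' ->
     let m := (a' + b') / 2 in let n := (c' + d') / 2 in
     P a' m c' n \/ P m b' c' n \/ P a' m n d' \/ P m b' n d') ->
  exists x y, a <= x <= b /\ c <= y <= d /\
    forall del, 0 < del -> exists a' b' c' d',
      a <= a' <= x /\ x <= b' <= b /\ c <= c' <= y /\ y <= d' <= d /\
      b' - a' < del /\ d' - c' < del /\ P a' b' c' d'.
Proof.
  intros Hab Hcd HP Hstep.
  set (q := fun n => Nat.iter n (quarter P) (a, b, c, d)).
  set (fa := fun n => fst (fst (fst (q n)))).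
  set (fb := fun n => snd (fst (fst (q n)))).
  set (fc := fun n => snd (fst (q n))).
  set (fd := fun n => snd (q n)).
  assert (Hinv : forall n, (a <= fa n /\ fa n <= fb n /\ fb n <= b) /\
     (c <= fc n /\ fc n <= fd n /\ fd n <= d) /\ P (fa n) (fb n) (fc n) (fd n)).
  { induction n as [|n IH]; [unfold fa, fb, fc, fd; simpl; repeat split; auto; lra|].
    unfold fa, fb, fc, fd in *; simpl; fold (q n).
    destruct (q n) as [[[a' b'] c'] d']; simpl in *.
    destruct IH as [[H1 [H2 H3]] [[H4 [H5 H6]] H7]].
    specialize (Hstep a' b' c' d' H1 H2 H3 H4 H5 H6 H7); simpl in Hstep.
    destruct (excluded_middle_informative (P a' ((a' + b') / 2) c' ((c' + d') / 2)));
      [simpl; repeat split; auto; lra|].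
    destruct (excluded_middle_informative (P ((a' + b') / 2) b' c' ((c' + d') / 2)));
      [simpl; repeat split; auto; lra|].
    destruct (excluded_middle_informative (P a' ((a' + b') / 2) ((c' + d') / 2) d'));
      simpl; repeat split; auto; try lra; tauto. }
  assert (Hmon : forall n, (fa n <= fa (S n) /\ fb (S n) <= fb n /\
     fb (S n) - fa (S n) = (fb n - fa n) / 2) /\
     (fc n <= fc (S n) /\ fd (S n) <= fd n /\ fd (S n) - fc (S n) = (fd n - fc n) / 2)).
  { intros n; destruct (Hinv n) as [H1 [H2 _]].
    unfold fa, fb, fc, fd in *; simpl; fold (q n).
    destruct (q n) as [[[a' b'] c'] d']; simpl in *.
    repeat destruct (excluded_middle_informative _); simpl; repeat split; lra. }
  assert (Hw : forall n, fb n - fa n = (b - a) * (/ 2) ^ n /\ fd n - fc n = (d - c) * (/ 2) ^ n).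
  { induction n as [|n IH]; [unfold fa, fb, fc, fd; simpl; lra|].
    destruct (Hmon n) as [[_ [_ H1]] [_ [_ H2]]]; rewrite H1, H2; simpl; lra. }
  destruct (nested_intervals_point fa fb) as [x Hx]; try (intros n; apply Hmon); try (intros n; apply Hinv).
  destruct (nested_intervals_point fc fd) as [y Hy]; try (intros n; apply Hmon); try (intros n; apply Hinv).
  exists x, y; split; [|split].
  - exact (Hx 0%nat).
  - exact (Hy 0%nat).
  - intros del Hdel.
    (* [A] dominates both sides; the [1] keeps it positive for a degenerate rectangle. *)
    set (A := (b - a) + (d - c) + 1).
    destruct (pow_lt_1_zero (/ 2)) with (y := del / A) as [N HN].
    + rewrite Rabs_right; lra.
    + apply Rdiv_lt_0_compat; unfold A; lra.
    + specialize (HN N (le_n N)).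
      assert (Hp : 0 < (/ 2) ^ N) by (apply pow_lt; lra).
      rewrite Rabs_right in HN by lra.
      assert (HA : A * (/ 2) ^ N < del).
      { apply (Rmult_lt_compat_l A) in HN; [|unfold A; lra].
        replace (A * (del / A)) with del in HN by (field; unfold A; lra). lra. }
      destruct (Hw N) as [Hw1 Hw2].
      destruct (Hinv N) as [H1 [H2 H3]].
      exists (fa N), (fb N), (fc N), (fd N).
      specialize (Hx N); specialize (Hy N).
      unfold A in HA.
      assert (0 <= (b - a) * (/ 2) ^ N) by (apply Rmult_le_pos; lra).
      assert (0 <= (d - c) * (/ 2) ^ N) by (apply Rmult_le_pos; lra).
      repeat split; try tauto; nra.
Qed.

(** * Maxima of continuous functions on closed disks *)

Definition Rcont (phi : C -> R) (z : C) : Prop :=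
  forall eps, 0 < eps -> exists del, 0 < del /\
    forall y, Cmod (y - z) < del -> Rabs (phi y - phi z) < eps.

Lemma Cmod_le_abs (z : C) : Cmod z <= Rabs (Re z) + Rabs (Im z).
Proof.
  destruct z as [x y].
  replace (x, y) with (RtoC x + Ci * RtoC y)%C by (unfold RtoC, Ci, Cplus, Cmult; simpl; f_equal; ring).
  assert (H := Cmod_triangle (RtoC x) (Ci * RtoC y)).
  rewrite Cmod_mult, Cmod_Ci, !Cmod_R in H.
  unfold Re, Im, RtoC, Ci, Cplus, Cmult in *; simpl in *.
  replace (x + (0 * y - 1 * 0)) with x by ring; replace (0 + (0 * 0 + 1 * y)) with y by ring.
  replace (x + (0 * y - 1 * 0)) with x in H by ring; replace (0 + (0 * 0 + 1 * y)) with y in H by ring.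
  lra.
Qed.

(** Bisection with the property that every value on the disk is matched or exceeded inside the
    rectangle. If all quarters failed, the best of the four witnesses would be matched by a point of
    the rectangle, which lies in one of the quarters. No upper bound on [phi] is needed beforehand;
    continuity at the limit point gives the maximum. *)
Lemma closed_disk_argmax (phi : C -> R) (r : R) :
  0 <= r -> (forall z, Cmod z <= r -> Rcont phi z) ->
  exists z0, Cmod z0 <= r /\ forall z, Cmod z <= r -> phi z <= phi z0.
Proof.
  intros Hr Hphi.
  set (P := fun a b c d => forall z, Cmod z <= r -> exists z' : C, Cmod z' <= r /\
     a <= Re z' <= b /\ c <= Im z' <= d /\ phi z <= phi z').
  destruct (rectangle_bisection P (- r) r (- r) r) as [x [y [_ [_ H]]]]; try lra.
  - intros z Hz; exists z.
    assert (H1 := re_le_Cmod z); assert (H2 := Im_le_Cmod z).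
    apply Rabs_le_between in H1; apply Rabs_le_between in H2.
    repeat split; lra.
  - intros a b c d _ _ _ _ _ _ HP m n.
    apply NNPP; intros Hn.
    apply not_or_and in Hn; destruct Hn as [N1 Hn].
    apply not_or_and in Hn; destruct Hn as [N2 Hn].
    apply not_or_and in Hn; destruct Hn as [N3 N4].
    assert (Hex : forall a b c d, ~ P a b c d -> exists z, Cmod z <= r /\
       forall z', Cmod z' <= r -> a <= Re z' <= b -> c <= Im z' <= d -> phi z' < phi z).
    { intros a' b' c' d' HN; apply not_all_ex_not in HN; destruct HN as [z HN].
      apply imply_to_and in HN; destruct HN as [Hz HN].
      exists z; split; auto; intros z' H1 H2 H3.
      apply Rnot_le_lt; intros H4; apply HN; exists z'; auto. }
    destruct (Hex _ _ _ _ N1) as [z1 [R1 M1]].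
    destruct (Hex _ _ _ _ N2) as [z2 [R2 M2]].
    destruct (Hex _ _ _ _ N3) as [z3 [R3 M3]].
    destruct (Hex _ _ _ _ N4) as [z4 [R4 M4]].
    assert (Hmax : exists z, Cmod z <= r /\ phi z1 <= phi z /\ phi z2 <= phi z /\
       phi z3 <= phi z /\ phi z4 <= phi z).
    { destruct (Rle_dec (phi z1) (phi z2)), (Rle_dec (phi z3) (phi z4));
      [destruct (Rle_dec (phi z2) (phi z4)) | destruct (Rle_dec (phi z2) (phi z3))
      |destruct (Rle_dec (phi z1) (phi z4)) | destruct (Rle_dec (phi z1) (phi z3))];
      first [exists z1; repeat split; auto; lra | exists z2; repeat split; auto; lra
        | exists z3; repeat split; auto; lra | exists z4; repeat split; auto; lra]. }
    destruct Hmax as [z [Hz Hm]].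
    destruct (HP z Hz) as [z' [Hz' [Hre [Him Hge]]]].
    specialize (M1 z' Hz'); specialize (M2 z' Hz'); specialize (M3 z' Hz'); specialize (M4 z' Hz').
    destruct (Rle_dec (Re z') m), (Rle_dec (Im z') n).
    + assert (phi z' < phi z1) by (apply M1; lra). lra.
    + assert (phi z' < phi z3) by (apply M3; lra). lra.
    + assert (phi z' < phi z2) by (apply M2; lra). lra.
    + assert (phi z' < phi z4) by (apply M4; lra). lra.
  - assert (Hnear : forall z, Cmod z <= r -> forall del, 0 < del -> exists z' : C,
      Cmod z' <= r /\ Cmod (z' - (x, y)) < del /\ phi z <= phi z').
    { intros z Hz del Hdel.
      destruct (H (del / 2)) as [a [b [c [d [Ha [Hb [Hc [Hd [W1 [W2 HP]]]]]]]]]]; [lra|].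
      destruct (HP z Hz) as [z' [Hz' [Hre [Him Hge]]]].
      exists z'; repeat split; auto.
      eapply Rle_lt_trans; [apply Cmod_le_abs|].
      unfold Cminus; rewrite re_plus, im_plus, re_opp, im_opp.
      unfold Re, Im in *; simpl.
      assert (Rabs (fst z' + - x) < del / 2) by (apply Rabs_lt_between; lra).
      assert (Rabs (snd z' + - y) < del / 2) by (apply Rabs_lt_between; lra).
      lra. }
    assert (Hin : Cmod (x, y) <= r).
    { apply Rnot_lt_le; intros Hlt.
      destruct (Hnear 0) with (del := Cmod (x, y) - r) as [z' [Hz' [Hd _]]];
        [rewrite Cmod_0; lra|lra|].
      assert (Ht := Cmod_triangle_rev (x, y) z'); rewrite Cmod_minus_sym in Ht; lra. }
    exists (x, y); split; auto; intros z Hz.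
    apply Rnot_lt_le; intros Hlt.
    destruct (Hphi (x, y) Hin (phi z - phi (x, y))) as [del [Hdel Hc]]; [lra|].
    destruct (Hnear z Hz del Hdel) as [z' [Hz' [Hd Hge]]].
    specialize (Hc z' Hd); apply Rabs_lt_between in Hc; lra.
Qed.

(** * Goursat's theorem *)

Lemma continuous_eps (f : R -> R) (x : R) :
  (forall eps, 0 < eps -> exists del, 0 < del /\
    forall y, Rabs (y - x) < del -> Rabs (f y - f x) < eps) -> continuous f x.
Proof.
  intros H; apply filterlim_locally; intros eps.
  destruct (H eps (cond_pos eps)) as [del [Hdel Hd]].
  exists (mkposreal del Hdel); intros y Hy; exact (Hd y Hy).
Qed.

(** Meant for [l] the real or imaginary part and [c] a horizontal or vertical line, so that the
    integrals along the sides of a rectangle exist. *)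
Lemma Ccont_continuous_lin (l : C -> R) (g : C -> C) (c : R -> C) (x : R) :
  (forall u v, l (u - v)%C = l u - l v) -> (forall u, Rabs (l u) <= Cmod u) ->
  (forall u v, Cmod (c u - c v) = Rabs (u - v)) ->
  Ccont g (c x) -> continuous (fun t => l (g (c t))) x.
Proof.
  intros Hl Hb Hc Hg; apply continuous_eps; intros eps He.
  destruct (Hg eps He) as [del [Hdel H]]; exists del; split; auto; intros y Hy.
  rewrite <- Hl; eapply Rle_lt_trans; [apply Hb|]; apply H; now rewrite Hc.
Qed.

Lemma Re_minus (u v : C) : Re (u - v) = Re u - Re v.
Proof. reflexivity. Qed.

Lemma Im_minus (u v : C) : Im (u - v) = Im u - Im v.
Proof. reflexivity. Qed.

Lemma Cmod_horizontal (x x' y : R) : Cmod ((x, y) - (x', y)) = Rabs (x - x').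
Proof.
  rewrite <- Cmod_R; f_equal; unfold Cminus, Cplus, Copp, RtoC; simpl; f_equal; ring.
Qed.

Lemma Cmod_vertical (x y y' : R) : Cmod ((x, y) - (x, y')) = Rabs (y - y').
Proof.
  rewrite <- Cmod_R, <- (Rmult_1_l (Cmod (y - y')%R)), <- Cmod_Ci, <- Cmod_mult.
  f_equal; unfold Cminus, Cplus, Copp, RtoC, Ci, Cmult; simpl; f_equal; ring.
Qed.

Lemma ex_RInt_horizontal (g : C -> C) (y a b : R) :
  a <= b -> (forall x, a <= x <= b -> Ccont g (x, y)) ->
  ex_RInt (fun x => Im (g (x, y))) a b.
Proof.
  intros Hab H; apply (ex_RInt_continuous (V := R_CompleteNormedModule)).
  intros x Hx; rewrite Rmin_left, Rmax_right in Hx by auto.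
  apply (Ccont_continuous_lin Im g (fun x => (x, y))); auto.
  - apply Im_le_Cmod.
  - intros; apply Cmod_horizontal.
Qed.

Lemma ex_RInt_vertical (g : C -> C) (x c d : R) :
  c <= d -> (forall y, c <= y <= d -> Ccont g (x, y)) ->
  ex_RInt (fun y => Re (g (x, y))) c d.
Proof.
  intros Hcd H; apply (ex_RInt_continuous (V := R_CompleteNormedModule)).
  intros y Hy; rewrite Rmin_left, Rmax_right in Hy by auto.
  apply (Ccont_continuous_lin Re g (fun y => (x, y))); auto.
  - apply re_le_Cmod.
  - intros; apply Cmod_vertical.
Qed.

(* The imaginary part of the integral of [g] along the boundary of the rectangle. *)
Definition rect_flux (g : C -> C) (a b c d : R) : R :=
  RInt (fun x => Im (g (x, c))) a b - RInt (fun x => Im (g (x, d))) a b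
  + RInt (fun y => Re (g (b, y))) c d - RInt (fun y => Re (g (a, y))) c d.

Lemma is_RInt_minus_minus_const (f g : R -> R) (a b k : R) :
  ex_RInt f a b -> ex_RInt g a b ->
  is_RInt (fun x => f x - g x - k) a b (RInt f a b - RInt g a b - (b - a) * k).
Proof.
  intros Hf Hg.
  exact (is_RInt_minus _ _ a b _ _
    (is_RInt_minus _ _ a b _ _ (RInt_correct _ _ _ Hf) (RInt_correct _ _ _ Hg))
    (is_RInt_const a b k)).
Qed.

(** An affine function has no flux. Opposite sides are paired point by point: the linear part
    contributes the constant [-(d - c) Re dg] to the horizontal pair and [(b - a) Re dg] to the
    vertical one, and their integrals cancel. What remains is at most [2 eps l] at each point, with
    [l] half the perimeter. *)
Lemma rect_flux_bound (g : C -> C) (a b c d : R) (t dg : C) (eps : R) :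
  a <= b -> c <= d -> a <= Re t <= b -> c <= Im t <= d -> 0 <= eps ->
  (forall x y, a <= x <= b -> c <= y <= d -> Ccont g (x, y)) ->
  (forall x y, a <= x <= b -> c <= y <= d ->
     Cmod (g (x, y) - g t - dg * ((x, y) - t)) <= eps * Cmod ((x, y) - t)) ->
  Rabs (rect_flux g a b c d) <= 2 * eps * ((b - a) + (d - c)) ^ 2.
Proof.
  intros Hab Hcd Ht1 Ht2 He Hg Hb.
  set (l := (b - a) + (d - c)).
  assert (Hl : forall x y, a <= x <= b -> c <= y <= d ->
     Cmod (g (x, y) - g t - dg * ((x, y) - t)) <= eps * l).
  { intros x y Hx Hy; eapply Rle_trans; [apply Hb; auto|].
    apply Rmult_le_compat_l; auto; eapply Rle_trans; [apply Cmod_le_abs|].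
    rewrite Re_minus, Im_minus.
    change (Re (x, y)) with x; change (Im (x, y)) with y.
    assert (Rabs (x - Re t) <= b - a) by (apply Rabs_le_between; lra).
    assert (Rabs (y - Im t) <= d - c) by (apply Rabs_le_between; lra).
    unfold l; lra. }
  assert (Hdiff : forall x y x' y', a <= x <= b -> c <= y <= d -> a <= x' <= b -> c <= y' <= d ->
     Cmod (g (x, y) - g (x', y') - dg * ((x, y) - (x', y'))) <= 2 * (eps * l)).
  { intros x y x' y' Hx Hy Hx' Hy'.
    replace (g (x, y) - g (x', y') - dg * ((x, y) - (x', y')))%C with
      ((g (x, y) - g t - dg * ((x, y) - t)) - (g (x', y') - g t - dg * ((x', y') - t)))%C by ring.
    eapply Rle_trans; [apply Cmod_triangle_minus|].
    assert (H1 := Hl x y Hx Hy); assert (H2 := Hl x' y' Hx' Hy'); lra. }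
  assert (I1 : ex_RInt (fun x => Im (g (x, c))) a b) by (apply ex_RInt_horizontal; auto; intros; apply Hg; lra).
  assert (I2 : ex_RInt (fun x => Im (g (x, d))) a b) by (apply ex_RInt_horizontal; auto; intros; apply Hg; lra).
  assert (I3 : ex_RInt (fun y => Re (g (b, y))) c d) by (apply ex_RInt_vertical; auto; intros; apply Hg; lra).
  assert (I4 : ex_RInt (fun y => Re (g (a, y))) c d) by (apply ex_RInt_vertical; auto; intros; apply Hg; lra).
  set (K := Re dg).
  assert (E1 := is_RInt_minus_minus_const _ _ a b (- ((d - c) * K)) I1 I2).
  assert (E2 := is_RInt_minus_minus_const _ _ c d ((b - a) * K) I3 I4).
  assert (E : rect_flux g a b c d =
    RInt (fun x => Im (g (x, c)) - Im (g (x, d)) - - ((d - c) * K)) a b +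
    RInt (fun y => Re (g (b, y)) - Re (g (a, y)) - (b - a) * K) c d).
  { rewrite (is_RInt_unique _ _ _ _ E1), (is_RInt_unique _ _ _ _ E2).
    unfold rect_flux; ring. }
  rewrite E; eapply Rle_trans; [apply Rabs_triang|].
  replace (2 * eps * l ^ 2) with ((b - a) * (2 * (eps * l)) + (d - c) * (2 * (eps * l))) by (unfold l; ring).
  apply Rplus_le_compat; apply abs_RInt_le_const; auto; try (eexists; eassumption).
  - intros x Hx; specialize (Hdiff x c x d Hx ltac:(lra) Hx ltac:(lra)).
    eapply Rle_trans; [|exact Hdiff]; eapply Rle_trans; [|apply Im_le_Cmod].
    right; f_equal; unfold K, Im, Re, Cminus, Cplus, Copp, Cmult; simpl; ring.
  - intros y Hy; specialize (Hdiff b y a y ltac:(lra) Hy ltac:(lra) Hy).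
    eapply Rle_trans; [|exact Hdiff]; eapply Rle_trans; [|apply re_le_Cmod].
    right; f_equal; unfold K, Im, Re, Cminus, Cplus, Copp, Cmult; simpl; ring.
Qed.

Lemma RInt_split_mid (f : R -> R) (a b : R) :
  a <= b -> ex_RInt f a b ->
  RInt f a b = RInt f a ((a + b) / 2) + RInt f ((a + b) / 2) b.
Proof.
  intros Hab Hf; symmetry; apply (RInt_Chasles f a ((a + b) / 2) b).
  - apply (ex_RInt_Chasles_1 f a _ b); auto; lra.
  - apply (ex_RInt_Chasles_2 f a _ b); auto; lra.
Qed.

(** Each inner edge occurs twice, with opposite signs. *)
Lemma rect_flux_quarter (g : C -> C) (a b c d : R) :
  a <= b -> c <= d ->
  (forall x y, a <= x <= b -> c <= y <= d -> Ccont g (x, y)) ->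
  let m := (a + b) / 2 in let n := (c + d) / 2 in
  rect_flux g a b c d = rect_flux g a m c n + rect_flux g m b c n
                        + rect_flux g a m n d + rect_flux g m b n d.
Proof.
  intros Hab Hcd Hg m n; unfold rect_flux.
  rewrite (RInt_split_mid (fun x => Im (g (x, c))) a b) by (auto; apply ex_RInt_horizontal; auto; intros; apply Hg; lra).
  rewrite (RInt_split_mid (fun x => Im (g (x, d))) a b) by (auto; apply ex_RInt_horizontal; auto; intros; apply Hg; lra).
  rewrite (RInt_split_mid (fun y => Re (g (a, y))) c d) by (auto; apply ex_RInt_vertical; auto; intros; apply Hg; lra).
  rewrite (RInt_split_mid (fun y => Re (g (b, y))) c d) by (auto; apply ex_RInt_vertical; auto; intros; apply Hg; lra).
  fold m n; ring.
Qed.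

(** If the flux were nonzero, [|flux| > k l^2], with [l] half the perimeter, would pass to some
    quarter, since halving [l] divides the right side by four. Near the limit point this contradicts
    the quadratic bound that differentiability there gives. *)
Theorem goursat_rectangle (g : C -> C) (a b c d : R) :
  a <= b -> c <= d ->
  (forall x y, a <= x <= b -> c <= y <= d -> exists dg, Cder g (x, y) dg) ->
  rect_flux g a b c d = 0.
Proof.
  intros Hab Hcd Hg.
  assert (Hcont : forall x y, a <= x <= b -> c <= y <= d -> Ccont g (x, y)).
  { intros x y Hx Hy; destruct (Hg x y Hx Hy) as [dg Hdg]; now apply Cder_Ccont in Hdg. }
  apply NNPP; intros HJ; apply Rabs_pos_lt in HJ.
  set (l := (b - a) + (d - c)).
  (* Dividing by [l ^ 2 + 1] makes the initial inequality strict and allows [l = 0]. *)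
  set (k := Rabs (rect_flux g a b c d) / (l ^ 2 + 1)).
  assert (Hl2 : 0 <= l ^ 2) by apply pow2_ge_0.
  assert (Hk : 0 < k) by (apply Rdiv_lt_0_compat; lra).
  set (P := fun a b c d => k * ((b - a) + (d - c)) ^ 2 < Rabs (rect_flux g a b c d)).
  destruct (rectangle_bisection P a b c d) as [x [y [Hx [Hy H]]]]; auto.
  - unfold P; fold l.
    assert (E : Rabs (rect_flux g a b c d) = k * (l ^ 2 + 1)) by (unfold k; field; lra).
    rewrite E; lra.
  - intros a' b' c' d' Ha Hab' Hb Hc Hcd' Hd HP m n.
    apply NNPP; intros Hn.
    apply not_or_and in Hn; destruct Hn as [N1 Hn].
    apply not_or_and in Hn; destruct Hn as [N2 Hn].
    apply not_or_and in Hn; destruct Hn as [N3 N4].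
    unfold P in *; apply Rnot_lt_le in N1; apply Rnot_lt_le in N2;
      apply Rnot_lt_le in N3; apply Rnot_lt_le in N4.
    assert (Hq : rect_flux g a' b' c' d' = rect_flux g a' m c' n + rect_flux g m b' c' n
                        + rect_flux g a' m n d' + rect_flux g m b' n d').
    { apply rect_flux_quarter; auto; intros; apply Hcont; lra. }
    set (l' := (b' - a') + (d' - c')) in *.
    replace (m - a' + (n - c')) with (l' / 2) in N1 by (unfold l', m, n; field).
    replace (b' - m + (n - c')) with (l' / 2) in N2 by (unfold l', m, n; field).
    replace (m - a' + (d' - n)) with (l' / 2) in N3 by (unfold l', m, n; field).
    replace (b' - m + (d' - n)) with (l' / 2) in N4 by (unfold l', m, n; field).
    replace (k * (l' / 2) ^ 2) with (k * l' ^ 2 / 4) in * by field.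
    apply Rabs_le_between in N1; apply Rabs_le_between in N2;
      apply Rabs_le_between in N3; apply Rabs_le_between in N4.
    revert HP; apply Rle_not_lt; rewrite Hq; apply Rabs_le_between; lra.
  - destruct (Hg x y Hx Hy) as [dg Hdg].
    (* [rect_flux_bound] doubles its [eps], so [k / 2] yields exactly the bound [k l^2]. *)
    destruct (Hdg (k / 2)) as [del [Hdel Hd]]; [lra|].
    destruct (H (del / 2)) as [a' [b' [c' [d' [Ha' [Hb' [Hc' [Hd' [W1 [W2 HP]]]]]]]]]]; [lra|].
    revert HP; unfold P; apply Rle_not_lt.
    replace (k * (b' - a' + (d' - c')) ^ 2) with (2 * (k / 2) * (b' - a' + (d' - c')) ^ 2) by field.
    apply (rect_flux_bound g a' b' c' d' (x, y) dg); unfold Re, Im; simpl; try lra.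
    + intros; apply Hcont; lra.
    + intros x' y' Hx' Hy'; apply Hd.
      eapply Rle_lt_trans; [apply Cmod_le_abs|].
      rewrite Re_minus, Im_minus; unfold Re, Im; simpl.
      assert (Rabs (x' - x) < del / 2) by (apply Rabs_lt_between; lra).
      assert (Rabs (y' - y) < del / 2) by (apply Rabs_lt_between; lra).
      lra.
Qed.

(** * The Schwarz lemma *)

(** It serves twice: as polar coordinates around a point, for mean values on circles, and to form
    the extremal function of (b). *)
Definition Cexp (z : C) : C := (exp (Re z) * cos (Im z), exp (Re z) * sin (Im z)).

Lemma Cexp_0 : Cexp 0 = 1.
Proof. unfold Cexp, Re, Im, RtoC; simpl; rewrite exp_0, cos_0, sin_0; f_equal; ring. Qed.

Lemma Cexp_plus (u v : C) : Cexp (u + v) = (Cexp u * Cexp v)%C.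
Proof.
  unfold Cexp; rewrite re_plus, im_plus, exp_plus, cos_plus, sin_plus.
  unfold Cmult; simpl; f_equal; ring.
Qed.

Lemma Cmod_Cexp (z : C) : Cmod (Cexp z) = exp (Re z).
Proof.
  assert (H := exp_pos (Re z)).
  apply Rsqr_inj; [apply Cmod_ge_0|lra|]; unfold Rsqr; rewrite Cmod_sqr.
  change (Re (Cexp z)) with (exp (Re z) * cos (Im z)).
  change (Im (Cexp z)) with (exp (Re z) * sin (Im z)).
  assert (H1 := sin2_cos2 (Im z)); unfold Rsqr in H1.
  transitivity (exp (Re z) * exp (Re z) * (sin (Im z) * sin (Im z) + cos (Im z) * cos (Im z)));
    [ring|rewrite H1; ring].
Qed.

Lemma Cexp_neq_0 (z : C) : Cexp z <> 0.
Proof. apply Cmod_gt_0; rewrite Cmod_Cexp; apply exp_pos. Qed.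

Lemma Cexp_R (x : R) : Cexp x = exp x.
Proof. unfold Cexp, Re, Im, RtoC; simpl; rewrite cos_0, sin_0; f_equal; ring. Qed.

Lemma is_derive_linear_approx (f : R -> R) (x l eps : R) :
  is_derive f x l -> 0 < eps -> exists del, 0 < del /\
    forall y, Rabs (y - x) < del -> Rabs (f y - f x - (y - x) * l) <= eps * Rabs (y - x).
Proof.
  intros [_ H] He; destruct (H x (fun P HP => HP) (mkposreal eps He)) as [del Hd].
  exists del; split; [apply cond_pos|]; intros y Hy; exact (Hd y Hy).
Qed.

Lemma Cder_Cexp_0 : Cder Cexp 0 1.
Proof.
  intros eps He.
  (* The error is at most [2 |A| + 2 |B| + 2 |D| + |a b|], seven terms of size [eta |y|]; [eta <= 1]
     gives [|1 + a| <= 2]. *)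
  set (eta := Rmin 1 (eps / 7)).
  assert (Heta : 0 < eta) by (apply Rmin_pos; lra).
  assert (H1 : eta <= 1) by apply Rmin_l.
  assert (H7 : eta <= eps / 7) by apply Rmin_r.
  assert (De : is_derive exp 0 1) by (assert (X := is_derive_exp 0); rewrite exp_0 in X; exact X).
  assert (Dc : is_derive cos 0 0) by (assert (X := is_derive_cos 0); rewrite sin_0, Ropp_0 in X; exact X).
  assert (Ds : is_derive sin 0 1) by (assert (X := is_derive_sin 0); rewrite cos_0 in X; exact X).
  destruct (is_derive_linear_approx _ _ _ eta De Heta) as [d1 [Hd1 B1]].
  destruct (is_derive_linear_approx _ _ _ eta Dc Heta) as [d2 [Hd2 B2]].
  destruct (is_derive_linear_approx _ _ _ eta Ds Heta) as [d3 [Hd3 B3]].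
  exists (Rmin (Rmin d1 eta) (Rmin d2 d3)); split; [apply Rmin_pos; apply Rmin_pos; auto|].
  intros y Hy; rewrite Cexp_0.
  replace (y - 0)%C with y in * by ring.
  assert (L1 := Rmin_l (Rmin d1 eta) (Rmin d2 d3)); assert (L2 := Rmin_r (Rmin d1 eta) (Rmin d2 d3)).
  assert (L3 := Rmin_l d1 eta); assert (L4 := Rmin_r d1 eta).
  assert (L5 := Rmin_l d2 d3); assert (L6 := Rmin_r d2 d3).
  assert (Ha := re_le_Cmod y); assert (Hb := Im_le_Cmod y).
  specialize (B1 (Re y)); specialize (B2 (Im y)); specialize (B3 (Im y)).
  rewrite Rminus_0_r in B1, B2, B3.
  rewrite exp_0 in B1; rewrite cos_0 in B2; rewrite sin_0 in B3.
  specialize (B1 ltac:(lra)); specialize (B2 ltac:(lra)); specialize (B3 ltac:(lra)).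
  set (a := Re y) in *; set (b := Im y) in *.
  assert (Hcb : Rabs (cos b) <= 1) by (apply Rabs_le_between, COS_bound).
  assert (Hsb : Rabs (sin b) <= 1) by (apply Rabs_le_between, SIN_bound).
  eapply Rle_trans; [apply Cmod_le_abs|].
  replace (Re (Cexp y - 1 - 1 * y)) with ((exp a - 1 - a * 1) * cos b + (1 + a) * (cos b - 1 - b * 0))
    by (unfold Cexp, a, b, Re, Im; simpl; ring).
  replace (Im (Cexp y - 1 - 1 * y)) with
    ((exp a - 1 - a * 1) * sin b + (1 + a) * (sin b - 0 - b * 1) + a * b)
    by (unfold Cexp, a, b, Re, Im; simpl; ring).
  set (A := exp a - 1 - a * 1) in *; set (B := cos b - 1 - b * 0) in *;
    set (D := sin b - 0 - b * 1) in *.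
  assert (X1 : Rabs (A * cos b + (1 + a) * B) <= Rabs A + 2 * Rabs B).
  { eapply Rle_trans; [apply Rabs_triang|]; rewrite !Rabs_mult.
    assert (Rabs (1 + a) <= 2).
    { eapply Rle_trans; [apply Rabs_triang|]; rewrite Rabs_R1; lra. }
    assert (N1 := Rabs_pos A); assert (N2 := Rabs_pos B).
    apply Rplus_le_compat; [|apply Rmult_le_compat_r; lra].
    rewrite <- (Rmult_1_r (Rabs A)) at 2; apply Rmult_le_compat_l; lra. }
  assert (X2 : Rabs (A * sin b + (1 + a) * D + a * b) <= Rabs A + 2 * Rabs D + eta * Rabs a).
  { eapply Rle_trans; [apply Rabs_triang|]; rewrite Rabs_mult with (x := a).
    assert (Rabs a * Rabs b <= eta * Rabs a).
    { rewrite Rmult_comm; apply Rmult_le_compat_r; [apply Rabs_pos|lra]. }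
    assert (Rabs (A * sin b + (1 + a) * D) <= Rabs A + 2 * Rabs D); [|lra].
    eapply Rle_trans; [apply Rabs_triang|]; rewrite !Rabs_mult.
    assert (Rabs (1 + a) <= 2).
    { eapply Rle_trans; [apply Rabs_triang|]; rewrite Rabs_R1; lra. }
    assert (N1 := Rabs_pos A); assert (N2 := Rabs_pos D).
    apply Rplus_le_compat; [|apply Rmult_le_compat_r; lra].
    rewrite <- (Rmult_1_r (Rabs A)) at 2; apply Rmult_le_compat_l; lra. }
  assert (eta * Rabs a <= eta * Cmod y) by (apply Rmult_le_compat_l; lra).
  assert (eta * Rabs b <= eta * Cmod y) by (apply Rmult_le_compat_l; lra).
  assert (eta * Cmod y <= eps / 7 * Cmod y) by (apply Rmult_le_compat_r; [apply Cmod_ge_0|lra]).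
  lra.
Qed.

Lemma Cder_Cexp (z : C) : Cder Cexp z (Cexp z).
Proof.
  apply (Cder_ext_loc (fun y => Cexp z * Cexp (y + - z))%C _ _ _ 1); [lra| |].
  - intros y _; rewrite <- Cexp_plus; f_equal; ring.
  - apply (Cder_eq _ _ (Cexp z * (1 * (1 + 0)))%C); [ring|].
    apply Cder_scal, (Cder_comp Cexp).
    + replace (z + - z)%C with (RtoC 0) by ring; apply Cder_Cexp_0.
    + apply (Cder_plus (fun y => y)); [apply Cder_id|apply Cder_const].
Qed.

(* [f] need not be differentiable at the centre of the disk: with
   [g zeta = f (z0 + exp zeta)], Goursat's theorem on the rectangle
   [[x, ln rho] x [0, 2 PI]] and the periodicity of [g] show that the mean of
   [Re f] over the circle of radius [exp x] does not depend on [x]; let [x]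
   tend to minus infinity. *)
Lemma circle_bound_centre (f : C -> C) (z0 : C) (rho K : R) :
  0 < rho ->
  (forall z : C, z <> z0 -> Cmod (z - z0) <= rho -> exists d, Cder f z d) ->
  Ccont f z0 ->
  (forall z, Cmod (z - z0) = rho -> Re (f z) <= K) -> Re (f z0) <= K.
Proof.
  intros Hrho Hd Hc HK.
  set (g := fun zeta => f (z0 + Cexp zeta)%C).
  assert (Hm : forall zeta, Cmod (z0 + Cexp zeta - z0) = exp (Re zeta)).
  { intros zeta; rewrite <- Cmod_Cexp; f_equal; ring. }
  assert (Hg : forall zeta, Re zeta <= ln rho -> exists d, Cder g zeta d).
  { intros zeta Hz.
    destruct (Hd (z0 + Cexp zeta)%C) as [d Hder].
    - intros E; apply (Cexp_neq_0 zeta).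
      replace (Cexp zeta) with (z0 + Cexp zeta - z0)%C by ring; rewrite E; ring.
    - rewrite Hm, <- (exp_ln rho) by auto.
      destruct Hz as [Hz|Hz]; [left; now apply exp_increasing|right; now rewrite Hz].
    - exists (d * (0 + Cexp zeta))%C; apply (Cder_comp f); auto.
      apply Cder_plus; [apply Cder_const|apply Cder_Cexp]. }
  assert (Hgc : forall zeta, Re zeta <= ln rho -> Ccont g zeta).
  { intros zeta Hz; destruct (Hg zeta Hz) as [d D]; now apply Cder_Ccont in D. }
  assert (HPI := PI_RGT_0).
  set (A := fun x => RInt (fun y => Re (g (x, y))) 0 (2 * PI)).
  assert (HA : forall x, x <= ln rho -> A x = A (ln rho)).
  { intros x Hx.
    assert (H := goursat_rectangle g x (ln rho) 0 (2 * PI) Hx ltac:(lra)).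
    unfold rect_flux in H; fold (A (ln rho)) (A x) in H.
    assert (E : RInt (fun x0 => Im (g (x0, 2 * PI))) x (ln rho)
      = RInt (fun x0 => Im (g (x0, 0))) x (ln rho)).
    { apply RInt_ext; intros t _; unfold g, Cexp, Re, Im; simpl.
      now rewrite cos_2PI, sin_2PI, cos_0, sin_0. }
    rewrite E in H.
    enough (RInt (fun x0 => Im (g (x0, 0))) x (ln rho) - RInt (fun x0 => Im (g (x0, 0))) x (ln rho)
      + A (ln rho) - A x = 0) by lra.
    apply H; intros x' y' Hx' _; apply Hg; unfold Re; simpl; lra. }
  assert (HI : forall x, x <= ln rho -> ex_RInt (fun y => Re (g (x, y))) 0 (2 * PI)).
  { intros x Hx; apply ex_RInt_vertical; [lra|]; intros; now apply Hgc. }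
  assert (Hup : A (ln rho) <= (2 * PI) * K).
  { replace (2 * PI * K) with (RInt (fun _ => K) 0 (2 * PI))
      by (rewrite RInt_const; unfold scal; simpl; unfold mult; simpl; ring).
    apply RInt_le; [lra|apply HI; lra|apply ex_RInt_const|].
    intros y _; apply HK; rewrite Hm; now apply exp_ln. }
  apply Rnot_lt_le; intros Hlt.
  set (e := (Re (f z0) - K) / 2).
  destruct (Hc e) as [del [Hdel H]]; [unfold e; lra|].
  set (x := Rmin (ln rho) (ln (del / 2))).
  assert (Hx : x <= ln rho) by apply Rmin_l.
  assert (Hxd : exp x < del).
  { apply Rle_lt_trans with (del / 2); [|lra].
    rewrite <- (exp_ln (del / 2)) by lra.
    assert (Hr : x <= ln (del / 2)) by apply Rmin_r.
    destruct Hr as [Hr|Hr]; [left; now apply exp_increasing|right; now rewrite Hr]. }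
  assert (Hlow : (2 * PI) * (Re (f z0) - e) <= A x).
  { replace (2 * PI * (Re (f z0) - e)) with (RInt (fun _ => Re (f z0) - e) 0 (2 * PI))
      by (rewrite RInt_const; unfold scal; simpl; unfold mult; simpl; ring).
    apply RInt_le; [lra|apply ex_RInt_const|now apply HI|].
    intros y _; specialize (H (z0 + Cexp (x, y))%C).
    rewrite Hm in H; specialize (H Hxd).
    assert (H' := re_le_Cmod (f (z0 + Cexp (x, y)) - f z0)%C).
    rewrite Re_minus in H'; apply Rabs_le_between in H'; unfold g; lra. }
  rewrite HA in Hlow by auto.
  assert (Hcmp : 2 * PI * (Re (f z0) - e) <= 2 * PI * K) by lra.
  apply Rmult_le_reg_l in Hcmp; [|lra]; unfold e in Hcmp; lra.
Qed.

Lemma Cmod_sqr_plus (u v : C) :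
  Cmod (u + v) ^ 2 = Cmod u ^ 2 + 2 * Re (Cconj u * v) + Cmod v ^ 2.
Proof.
  replace (Cmod (u + v) ^ 2) with (Cmod (u + v) * Cmod (u + v)) by ring.
  replace (Cmod u ^ 2) with (Cmod u * Cmod u) by ring.
  replace (Cmod v ^ 2) with (Cmod v * Cmod v) by ring.
  rewrite !Cmod_sqr, re_plus, im_plus, re_mult, re_conj, im_conj; ring.
Qed.

(* An interior maximum of [Re f + e |z|^2] is excluded by [circle_bound_centre]
   because [|z0 + h|^2 - |z0|^2 - |h|^2] is the real part of an affine function. *)
Lemma max_principle (f : C -> C) (r M : R) :
  0 < r < 1 ->
  (forall z, Cmod z < 1 -> Ccont f z) ->
  (forall z : C, z <> 0 -> Cmod z < 1 -> exists d, Cder f z d) ->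
  (forall z, Cmod z = r -> Re (f z) <= M) ->
  forall z, Cmod z <= r -> Re (f z) <= M.
Proof.
  intros Hr Hc Hd HM z Hz.
  apply le_epsilon; intros e He.
  set (phi := fun z => Re (f z) + e * Cmod z ^ 2).
  destruct (closed_disk_argmax phi r) as [z0 [Hz0 Hmax]]; [lra| |].
  - intros y Hy eps Heps.
    assert (Hm : Ccont (fun y => RtoC (Cmod y)) y).
    { intros ep Hep; exists ep; split; auto; intros y' Hy'.
      rewrite <- RtoC_minus, Cmod_R.
      eapply Rle_lt_trans; [|exact Hy'].
      apply Rabs_le_between; assert (H1 := Cmod_triangle_rev y' y);
        assert (H2 := Cmod_triangle_rev y y'); rewrite (Cmod_minus_sym y y') in H2; lra. }
    assert (Hphi : Ccont (fun y => f y + RtoC e * (RtoC (Cmod y) * RtoC (Cmod y)))%C y).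
    { apply Ccont_plus; [apply Hc; lra|]; apply Ccont_mult; [apply Ccont_const|].
      now apply Ccont_mult. }
    destruct (Hphi eps Heps) as [del [Hdel H]]; exists del; split; auto.
    intros y' Hy'; eapply Rle_lt_trans; [|exact (H y' Hy')].
    eapply Rle_trans; [|apply re_le_Cmod]; right; f_equal.
    unfold phi, Re; simpl; ring.
  - assert (Hzz : Re (f z) <= phi z).
    { unfold phi; assert (0 <= e * Cmod z ^ 2); [|lra].
      apply Rmult_le_pos; [lra|apply pow2_ge_0]. }
    apply Rle_trans with (1 := Hzz); apply Rle_trans with (1 := Hmax z Hz).
    destruct (Rle_lt_or_eq_dec _ _ Hz0) as [Hlt|Heq].
    + exfalso.
      (* The circle must stay in the disk of radius [r], and its interior may contain [0] only as
         its centre, the one point where [circle_bound_centre] asks for no derivative. *)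
      assert (Hrho : exists rho, 0 < rho /\ Cmod z0 + rho <= r /\ (z0 <> 0 -> rho < Cmod z0)).
      { destruct (Ceq_dec z0 0) as [E|E].
        - exists (r - Cmod z0); repeat split; [lra|lra|tauto].
        - apply Cmod_gt_0 in E; exists (Rmin (r - Cmod z0) (Cmod z0 / 2)).
          assert (H1 := Rmin_l (r - Cmod z0) (Cmod z0 / 2)).
          assert (H2 := Rmin_r (r - Cmod z0) (Cmod z0 / 2)).
          repeat split; try lra; apply Rmin_pos; lra. }
      destruct Hrho as [rho [Hrho [Hrr Hr0]]].
      (* On the circle [e |y|^2 = e |z0|^2 + Re (c (y - z0)) + e rho^2], so maximality of [phi] at
         [z0] bounds [Re F] there by [Re (f z0) - e rho^2]. *)
      set (c := (2 * e * Cconj z0)%C).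
      set (F := fun y => (f y + c * (y + - z0))%C).
      assert (HF : Re (F z0) <= Re (f z0) - e * rho ^ 2).
      { apply (circle_bound_centre F z0 rho); auto.
        - intros y Hy Hyr.
          assert (Hy1 : Cmod y <= r).
          { replace y with (z0 + (y - z0))%C by ring.
            eapply Rle_trans; [apply Cmod_triangle|lra]. }
          destruct (Hd y) as [d D]; [|lra|].
          + intros ->; replace (0 - z0)%C with (- z0)%C in Hyr by ring.
            rewrite Cmod_opp in Hyr; assert (z0 <> 0) by auto.
            specialize (Hr0 H); lra.
          + exists (d + c * (1 + 0))%C; apply Cder_plus; auto.
            apply Cder_scal, (Cder_plus (fun x => x)); [apply Cder_id|apply Cder_const].
        - apply Ccont_plus; [apply Hc; lra|]; apply Ccont_mult; [apply Ccont_const|].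
          apply Ccont_plus; [apply Ccont_id|apply Ccont_const].
        - intros y Hy.
          assert (Hy1 : Cmod y <= r).
          { replace y with (z0 + (y - z0))%C by ring.
            eapply Rle_trans; [apply Cmod_triangle|lra]. }
          specialize (Hmax y Hy1); unfold phi in Hmax.
          assert (E := Cmod_sqr_plus z0 (y - z0)).
          replace (z0 + (y - z0))%C with y in E by ring.
          rewrite Hy in E; rewrite E in Hmax.
          unfold F; rewrite re_plus; unfold c.
          replace (2 * e * Cconj z0 * (y + - z0))%C with (RtoC (2 * e) * (Cconj z0 * (y - z0)))%C
            by (rewrite RtoC_mult; ring).
          rewrite re_scal_l; lra. }
      unfold F in HF; replace (f z0 + c * (z0 + - z0))%C with (f z0) in HF by ring.
      assert (0 < e * rho ^ 2) by (apply Rmult_lt_0_compat; [lra|apply pow_lt; lra]).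
      lra.
    + unfold phi; rewrite Heq; specialize (HM z0 Heq).
      assert (e * r ^ 2 <= e * 1); [|lra].
      apply Rmult_le_compat_l; [lra|]; nra.
Qed.

(** The maximum principle is applied to [phi = w z / z], extended to [0] as the slope function of
    [w]. On [|z| = r] it is bounded by [1 / r]; then [r] is taken close to [1]. *)
Theorem schwarz_lemma (w : C -> C) :
  analytic_in_disk w -> w 0 = 0 -> (forall z, in_disk z -> Cmod (w z) < 1) ->
  forall z, in_disk z -> Cmod (w z) <= Cmod z.
Proof.
  intros Ha H0 Hw.
  rewrite analytic_Cder in Ha.
  destruct (Ha 0) as [d0 D0]; [unfold in_disk; rewrite Cmod_0; lra|].
  destruct (Cder_slope _ _ _ D0) as [phi [Hc [_ Hphi]]].
  assert (E : forall y, w y = (y * phi y)%C) by (intros y; rewrite Hphi, H0; ring).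
  assert (Hd : forall z : C, z <> 0 -> Cmod z < 1 -> exists d, Cder phi z d).
  { intros z Hz Hz1; destruct (Ha z Hz1) as [d D].
    exists (d * / z + w z * - / (z * z))%C.
    apply (Cder_ext_loc (fun y => w y * / y)%C _ _ _ (Cmod z)); [now apply Cmod_gt_0| |].
    - intros y Hy; rewrite E; field; intros ->.
      replace (0 - z)%C with (- z)%C in Hy by ring; rewrite Cmod_opp in Hy; lra.
    - apply Cder_mult; auto; now apply Cder_inv. }
  assert (Hcont : forall z, Cmod z < 1 -> Ccont phi z).
  { intros z Hz; destruct (Ceq_dec z 0) as [->|Hz0]; auto.
    destruct (Hd z Hz0 Hz) as [d D]; now apply Cder_Ccont in D. }
  assert (Hb : forall a r, Cmod a <= r -> 0 < r < 1 -> Cmod (phi a) <= / r).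
  { intros a r Har Hr.
    destruct (Ceq_dec (phi a) 0) as [Z|Z].
    { rewrite Z, Cmod_0; left; apply Rinv_0_lt_compat; lra. }
    apply Cmod_gt_0 in Z as Zp.
    (* A rotation making [phi a] real and positive: the maximum principle bounds real parts only. *)
    set (c := (Cconj (phi a) / Cmod (phi a))%C).
    assert (HcR : RtoC (Cmod (phi a)) <> 0) by (intros X; apply RtoC_inj in X; lra).
    assert (Hc1 : Cmod c = 1).
    { unfold c; rewrite Cmod_div, Cmod_conj, Cmod_R, Rabs_right by (auto; lra); field; lra. }
    replace (Cmod (phi a)) with (Re (c * phi a)%C).
    2:{ replace (c * phi a)%C with (RtoC (Cmod (phi a))); [reflexivity|].
        unfold c; transitivity (RtoC (Cmod (phi a) * Cmod (phi a)) / RtoC (Cmod (phi a)))%C.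
        - rewrite RtoC_mult; field; auto.
        - replace (RtoC (Cmod (phi a) * Cmod (phi a))) with (Cconj (phi a) * phi a)%C; [field; auto|].
          rewrite Cmod_sqr; unfold Cconj, Cmult, RtoC, Re, Im; simpl; f_equal; ring. }
    apply (max_principle (fun y => c * phi y)%C r); auto.
    - intros y Hy; apply Ccont_mult; [apply Ccont_const|auto].
    - intros y Hy Hy1; destruct (Hd y Hy Hy1) as [d D]; exists (c * d)%C; now apply Cder_scal.
    - intros y Hy; eapply Rle_trans; [apply Re_le_Cmod|].
      rewrite Cmod_mult, Hc1, Rmult_1_l.
      assert (Hwy : Cmod (w y) < 1) by (apply Hw; unfold in_disk; lra).
      rewrite E, Cmod_mult, Hy in Hwy.
      apply (Rmult_le_reg_l r); [lra|]; rewrite Rinv_r by lra; lra. }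
  intros z Hz; unfold in_disk in Hz; rewrite E, Cmod_mult.
  assert (H1 : Cmod (phi z) <= 1).
  { apply Rnot_lt_le; intros Hlt.
    (* With this [r], [|phi z| <= 1 / r] would be at most the mean of [1] and [|phi z|]. *)
    set (r := Rmax (Cmod z) (/ ((1 + Cmod (phi z)) / 2))).
    assert (Hp := Cmod_ge_0 z).
    assert (Hinv : 0 < / ((1 + Cmod (phi z)) / 2) < 1).
    { split; [apply Rinv_0_lt_compat; lra|]; rewrite <- Rinv_1; apply Rinv_lt_contravar; lra. }
    assert (Hr : 0 < r < 1).
    { split; [apply Rlt_le_trans with (1 := proj1 Hinv); apply Rmax_r|now apply Rmax_lub_lt]. }
    assert (Hbz := Hb z r (Rmax_l _ _) Hr).
    assert (/ r <= (1 + Cmod (phi z)) / 2); [|lra].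
    rewrite <- (Rinv_inv ((1 + Cmod (phi z)) / 2)); apply Rinv_le_contravar; [lra|apply Rmax_r]. }
  rewrite <- (Rmult_1_r (Cmod z)) at 2; apply Rmult_le_compat_l; [apply Cmod_ge_0|auto].
Qed.

(** * Growth along rays *)

(* With [u = phi_cr w - 1] one has [u (u + 2) = 2 w (u + 1)], and [|u + 2| / |u + 1|]
   is smallest on the circle [|u| = rho] at [u = rho] as long as [rho^2 <= 2]. *)
Lemma phi_cr_growth (w : C) (r : R) :
  Cmod w <= r -> r < 1 -> Cmod (phi_cr w - 1) <= r + sqrt (1 + r ^ 2) - 1.
Proof.
  intros Hw Hr.
  assert (Hs2 := Csqrt_sqr (1 + w ^ 2)); assert (Hs0 := Csqrt_Re_ge_0 (1 + w ^ 2)).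
  unfold phi_cr; set (s := Csqrt (1 + w ^ 2)) in *.
  assert (Hm := Cmod_sqr w); assert (Hwp := Cmod_ge_0 w).
  assert (Hu := Cmod_sqr (w + s - 1)).
  set (rho := Cmod (w + s - 1)) in *.
  assert (Hrho : 0 <= rho) by apply Cmod_ge_0.
  set (mw := Cmod w) in *; clearbody rho mw s.
  destruct w as [a b], s as [p q].
  unfold Re, Im, Cminus, Cplus, Copp, RtoC, Cmult, Cpow in *; simpl in *.
  injection Hs2; clear Hs2; intros Eim Ere.
  assert (E1 : p * p - q * q = 1 + (a * a - b * b)) by (rewrite Ere; ring).
  assert (E2 : p * q = a * b) by lra.
  assert (Hu' : rho * rho = (a + p - 1) * (a + p - 1) + (b + q) * (b + q)) by (rewrite Hu; ring).
  clear Hu Eim Ere.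
  (* Write [v = x + i y] for [phi_cr w], so [N = |v|^2]. [V1], [V2] say [v (s - w) = 1]; [W1], [W2]
     say [v^2 - 1 = 2 w v]; [W] is the squared modulus of the latter. *)
  set (x := a + p) in *; set (y := b + q) in *.
  set (N := x * x + y * y).
  assert (V1 : x * (p - a) - y * (q - b) = 1) by (unfold x, y; nra).
  assert (V2 : x * (q - b) + y * (p - a) = 0) by (unfold x, y; nra).
  assert (HN : N * (p - a) = x).
  { transitivity (x * (x * (p - a) - y * (q - b)) + y * (x * (q - b) + y * (p - a)));
      [unfold N; ring|rewrite V1, V2; ring]. }
  assert (W1 : x * x - y * y - 1 = 2 * (a * x - b * y)) by (unfold x, y; nra).
  assert (W2 : x * y = a * y + b * x) by (unfold x, y; nra).
  assert (W : (N - 1) * (N - 1) + 4 * (y * y) = 4 * (mw * mw) * N).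
  { rewrite Hm.
    transitivity ((x * x - y * y - 1) * (x * x - y * y - 1) + 4 * (x * y) * (x * y));
      [unfold N; ring|rewrite W1, W2; unfold N; ring]. }
  assert (HN0 : 0 < N).
  { assert (0 <= x * x) by nra; assert (0 <= y * y) by nra.
    destruct (Req_dec N 0) as [Z|Z]; [|unfold N in *; lra].
    assert (x * x = 0) by (unfold N in Z; lra); assert (y * y = 0) by (unfold N in Z; lra).
    assert (x = 0) by nra; assert (y = 0) by nra; nra. }
  (* The principal branch enters here: [2 s = v + 1 / v], so [Re v] has the sign of [Re s]. *)
  assert (Hx : 0 <= x).
  { assert (X : N * (2 * p) = x * (1 + N)) by (rewrite Rmult_plus_distr_l, <- HN at 1; unfold x; ring).
    apply Rnot_lt_le; intros Hneg.
    assert (0 <= N * (2 * p)) by (apply Rmult_le_pos; lra).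
    assert (x * (1 + N) < 0) by nra; lra. }
  assert (Hmw1 : mw * mw < 1) by nra.
  (* [W] and [|w| < 1] give [(N - 1)^2 < 4 (N - y^2) = 4 x^2]. As [x >= 0], [N - 2 x < 1], which is
     [rho^2 < 2]. *)
  assert (Hlt : (N - 1) * (N - 1) < (2 * x) * (2 * x)).
  { assert (4 * (mw * mw) * N < 4 * N) by nra; unfold N in *; lra. }
  assert (HN1 : N - 1 < 2 * x) by nra.
  assert (Hrho2 : rho * rho < 2) by (rewrite Hu'; unfold N in HN1; lra).
  set (X := x - 1) in *.
  assert (HX : X <= rho) by nra.
  assert (Eq : (rho * rho) * (rho * rho + 4 * X + 4) = 4 * (mw * mw) * (rho * rho + 2 * X + 1)).
  { replace (rho * rho + 2 * X + 1) with N by (rewrite Hu'; unfold N, X; ring).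
    rewrite <- W, Hu'; unfold N, X; ring. }
  set (D := rho * rho + 4 * X + 4) in *.
  assert (HD : 0 < D) by (unfold D, X; nra).
  (* [X] is [Re u] and [D] is [|u + 2|^2]. The right side minus the left is exactly
     [(2 rho^2 - 4) (X - rho)], a product of two nonpositive factors. *)
  assert (Hmon : (rho * rho + 2 * X + 1) * ((rho + 2) * (rho + 2)) <= ((rho + 1) * (rho + 1)) * D).
  { assert (0 <= (2 * (rho * rho) - 4) * (X - rho)) by nra.
    unfold D; nra. }
  assert (Hsq : (rho * (rho + 2)) * (rho * (rho + 2)) <= (2 * r * (rho + 1)) * (2 * r * (rho + 1))).
  { apply (Rmult_le_reg_r D); auto.
    apply Rle_trans with (4 * (mw * mw) * ((rho * rho + 2 * X + 1) * ((rho + 2) * (rho + 2)))).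
    - right; transitivity ((rho * rho * D) * ((rho + 2) * (rho + 2))); [ring|rewrite Eq; ring].
    - apply Rle_trans with (4 * (mw * mw) * ((rho + 1) * (rho + 1) * D)).
      + apply Rmult_le_compat_l; auto; nra.
      + assert (mw * mw <= r * r) by nra.
        assert (0 <= (rho + 1) * (rho + 1) * D) by (apply Rmult_le_pos; nra).
        nra. }
  assert (Hlin : rho * (rho + 2) <= 2 * r * (rho + 1)).
  { apply Rsqr_incr_0_var; [exact Hsq|apply Rmult_le_pos; lra]. }
  replace (r * (r * 1)) with (r * r) by ring.
  (* Completing the square: [Hlin] is equivalent to [(rho + 1 - r)^2 <= 1 + r^2]. *)
  assert (rho + 1 - r <= sqrt (1 + r * r)); [|lra].
  apply Rle_trans with (1 := Rle_abs _); rewrite <- sqrt_Rsqr_abs; apply sqrt_le_1_alt.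
  unfold Rsqr; nra.
Qed.

(* The primitive of [(phi_cr t - 1) / t] vanishing at [0]. *)
Definition cr_primitive (t : R) : R :=
  t + sqrt (1 + t ^ 2) - 1 + ln 2 - ln (1 + sqrt (1 + t ^ 2)).

(** The quotient [(phi_cr t - 1) / t], rationalised so that it also makes sense at [t = 0]. *)
Definition cr_slope (t : R) : R := 1 + t / (1 + sqrt (1 + t ^ 2)).

Lemma cr_slope_id (t : R) : t * cr_slope t = t + sqrt (1 + t ^ 2) - 1.
Proof.
  unfold cr_slope; assert (H := sqrt_pos (1 + t ^ 2)).
  assert (Hs : sqrt (1 + t ^ 2) * sqrt (1 + t ^ 2) = 1 + t ^ 2) by (apply sqrt_sqrt; nra).
  apply (Rmult_eq_reg_r (1 + sqrt (1 + t ^ 2))); [|lra].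
  transitivity (t * (1 + sqrt (1 + t ^ 2)) + t ^ 2); [field; lra|nra].
Qed.

Lemma is_derive_cr_primitive (t : R) : is_derive cr_primitive t (cr_slope t).
Proof.
  assert (H : 0 < 1 + t ^ 2) by nra; assert (Hs := sqrt_lt_R0 _ H).
  assert (Hss : sqrt (1 + t ^ 2) * sqrt (1 + t ^ 2) = 1 + t ^ 2) by (apply sqrt_sqrt; lra).
  unfold cr_primitive, cr_slope; auto_derive.
  - replace (t * (t * 1)) with (t ^ 2) by ring; repeat split; lra.
  - replace (t * (t * 1)) with (t ^ 2) by ring; field; lra.
Qed.

Lemma cr_primitive_0 : cr_primitive 0 = 0.
Proof.
  unfold cr_primitive; replace (1 + 0 ^ 2) with 1 by ring; rewrite sqrt_1.
  replace (1 + 1) with 2 by ring; ring.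
Qed.

Lemma cr_primitive_1 : cr_primitive 1 = sqrt 2 - ln (1 + sqrt 2) + ln 2.
Proof. unfold cr_primitive; replace (1 + 1 ^ 2) with 2 by ring; ring. Qed.

Lemma cr_slope_ge_1 (t : R) : 0 <= t -> 1 <= cr_slope t.
Proof.
  intros Ht; unfold cr_slope; assert (H := sqrt_pos (1 + t ^ 2)).
  assert (0 <= t / (1 + sqrt (1 + t ^ 2))); [apply Rdiv_le_0_compat; lra|lra].
Qed.

Lemma cr_primitive_lt (s t : R) : 0 <= s -> s < t -> cr_primitive s < cr_primitive t.
Proof.
  intros Hs Hst.
  apply (incr_function_le cr_primitive 0 t cr_slope); simpl; try lra.
  - intros x _ _; apply is_derive_cr_primitive.
  - intros x Hx _; assert (H := cr_slope_ge_1 x Hx); lra.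
Qed.

Lemma cr_primitive_le (s t : R) : 0 <= s -> s <= t -> cr_primitive s <= cr_primitive t.
Proof.
  intros Hs [Hst| ->]; [left; now apply cr_primitive_lt|lra].
Qed.

(** * Comparison with a differential equation along rays *)

Lemma is_derive_of_approx (f : R -> R) (x l : R) :
  (forall eps, 0 < eps -> exists del, 0 < del /\
    forall y, Rabs (y - x) < del -> Rabs (f y - f x - (y - x) * l) <= eps * Rabs (y - x)) ->
  is_derive f x l.
Proof.
  intros H; split; [apply is_linear_scal_l|].
  intros x' Hx' eps.
  apply (is_filter_lim_locally_unique (V := R_NormedModule)) in Hx'; subst x'.
  destruct (H eps (cond_pos eps)) as [del [Hdel Hd]].
  exists (mkposreal del Hdel); intros y Hy; exact (Hd y Hy).
Qed.

(** Let [T] be the end of the longest initial interval on which [f] is negative. If [f T < 0], the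
    interval extends unless [T = 1]; [f T > 0] contradicts continuity from the left; if [f T = 0],
    the negative derivative makes [f] positive just before [T]. *)
Lemma negative_of_no_upcrossing (f df : R -> R) :
  (forall t, 0 <= t <= 1 -> is_derive f t (df t)) -> f 0 < 0 ->
  (forall t, 0 < t <= 1 -> f t = 0 -> df t < 0) -> f 1 < 0.
Proof.
  intros Hd H0 Hcross; apply Rnot_le_lt; intros H1.
  set (E := fun t => 0 <= t <= 1 /\ forall s, 0 <= s <= t -> f s < 0).
  destruct (completeness E) as [T [HT1 HT2]].
  { exists 1; intros t [Ht _]; lra. }
  { exists 0; split; [lra|]; intros s Hs; replace s with 0 by lra; auto. }
  assert (HE0 : E 0) by (split; [lra|]; intros s Hs; replace s with 0 by lra; auto).
  assert (HT : 0 <= T <= 1).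
  { split; [now apply HT1|apply HT2; intros t [Ht _]; lra]. }
  assert (Hbelow : forall s, 0 <= s < T -> f s < 0).
  { intros s Hs; apply NNPP; intros Hn.
    assert (T <= s); [|lra].
    apply HT2; intros t [Ht HtE]; apply Rnot_lt_le; intros Hst; apply Hn, HtE; lra. }
  assert (Hcont : forall eps, 0 < eps -> exists del, 0 < del /\
    forall y, Rabs (y - T) < del -> Rabs (f y - f T) < eps).
  { assert (C0 : continuous f T).
    { apply (ex_derive_continuous (V := R_NormedModule)); exists (df T); auto. }
    intros eps He; apply filterlim_locally with (eps := mkposreal eps He) in C0.
    destruct C0 as [del Hdel]; exists del; split; [apply cond_pos|exact Hdel]. }
  destruct (Rtotal_order (f T) 0) as [Hneg|[Hz|Hpos]].
  - destruct (Hcont (- f T)) as [del [Hdel Hc]]; [lra|].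
    destruct (Rlt_le_dec T 1) as [HTlt|HTge].
    2:{ replace T with 1 in Hneg by lra; lra. }
    set (T' := Rmin 1 (T + del / 2)).
    assert (HT' : T < T') by (apply Rmin_glb_lt; lra).
    assert (T' <= 1) by apply Rmin_l; assert (T' <= T + del / 2) by apply Rmin_r.
    assert (T' <= T); [|lra].
    apply HT1; split; [lra|]; intros s Hs.
    destruct (Rlt_le_dec s T) as [Hlt|Hge]; [apply Hbelow; lra|].
    assert (Hs' : Rabs (s - T) < del) by (apply Rabs_lt_between; lra).
    specialize (Hc s Hs'); apply Rabs_lt_between in Hc; lra.
  - assert (HTpos : 0 < T).
    { destruct (proj1 HT) as [|<-]; [auto|lra]. }
    assert (Hdf := Hcross T ltac:(lra) Hz).
    destruct (is_derive_linear_approx f T (df T) (- df T / 2) (Hd T HT)) as [del [Hdel Ha]]; [lra|].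
    set (s := Rmax 0 (T - del / 2)).
    assert (0 <= s) by apply Rmax_l; assert (T - del / 2 <= s) by apply Rmax_r.
    assert (s < T) by (apply Rmax_lub_lt; lra).
    assert (Hs : Rabs (s - T) = T - s) by (rewrite Rabs_left; lra).
    specialize (Ha s); rewrite Hs, Hz in Ha; specialize (Ha ltac:(lra)).
    apply Rabs_le_between in Ha; specialize (Hbelow s ltac:(lra)); nra.
  - destruct (Hcont (f T)) as [del [Hdel Hc]]; [lra|].
    assert (HTpos : 0 < T).
    { destruct (proj1 HT) as [|<-]; [auto|lra]. }
    set (s := Rmax 0 (T - del / 2)).
    assert (0 <= s) by apply Rmax_l; assert (T - del / 2 <= s) by apply Rmax_r.
    assert (s < T) by (apply Rmax_lub_lt; lra).
    assert (Hs : Rabs (s - T) < del) by (apply Rabs_lt_between; lra).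
    specialize (Hc s Hs); apply Rabs_lt_between in Hc; specialize (Hbelow s ltac:(lra)); lra.
Qed.

Lemma Cder_ray (l : C -> R) (f : C -> C) (z d : C) (t : R) :
  (forall u v, l (u - v)%C = l u - l v) -> (forall (x : R) u, l (x * u)%C = x * l u) ->
  (forall u, Rabs (l u) <= Cmod u) ->
  Cder f (t * z)%C d -> is_derive (fun t : R => l (f (t * z)%C)) t (l (d * z)%C).
Proof.
  intros Hsub Hscal Hb Hf; apply is_derive_of_approx; intros eps He.
  assert (Hz := Cmod_ge_0 z); set (A := Cmod z + 1).
  destruct (Hf (eps / A)) as [del [Hdel H]]; [apply Rdiv_lt_0_compat; unfold A; lra|].
  exists (del / A); split; [apply Rdiv_lt_0_compat; unfold A; lra|]; intros y Hy.
  assert (Hm : Cmod (y * z - t * z) = Rabs (y - t) * Cmod z).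
  { replace (y * z - t * z)%C with (RtoC (y - t) * z)%C by (rewrite RtoC_minus; ring).
    now rewrite Cmod_mult, Cmod_R. }
  assert (Hyz : Rabs (y - t) * Cmod z <= Rabs (y - t) * A).
  { apply Rmult_le_compat_l; [apply Rabs_pos|unfold A; lra]. }
  assert (HyA : Rabs (y - t) * A < del).
  { apply (Rmult_lt_compat_r A) in Hy; [|unfold A; lra].
    replace (del / A * A) with del in Hy by (field; unfold A; lra); lra. }
  rewrite <- !Hsub, <- Hscal, <- Hsub.
  eapply Rle_trans; [apply Hb|].
  specialize (H (y * z)%C); rewrite Hm in H; specialize (H ltac:(lra)).
  replace (f (y * z) - f (t * z) - RtoC (y - t) * (d * z))%C
    with (f (y * z) - f (t * z) - d * (y * z - t * z))%C by (rewrite RtoC_minus; ring).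
  apply Rle_trans with (1 := H).
  apply Rle_trans with (eps / A * (Rabs (y - t) * A)).
  - apply Rmult_le_compat_l; [|auto]; left; apply Rdiv_lt_0_compat; unfold A; lra.
  - right; field; unfold A; lra.
Qed.

Lemma inner_le_Cmod (u v : C) : Re u * Re v + Im u * Im v <= Cmod u * Cmod v.
Proof.
  rewrite <- (Cmod_conj u), <- Cmod_mult; eapply Rle_trans; [|apply Re_le_Cmod].
  rewrite re_mult, re_conj, im_conj; lra.
Qed.

(* Along the ray [t |-> t z] the distance [|p - 1|] starts below the solution
   [H (s t)] of [y' = Theta y * s'], where [s = (cr_primitive (t |z|) + e (1 + t)) / beta],
   and cannot cross it. *)
Lemma ray_comparison (p : C -> C) (beta c : R) (Theta H : R -> R) (z : C) :
  0 < beta -> cr_primitive 1 <= c * beta ->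
  (forall s, 0 <= s <= c -> is_derive H s (Theta (H s)) /\ 0 < Theta (H s)) ->
  (forall s, 0 < s <= c -> 0 < H s <= 2 / 3) ->
  analytic_in_disk p -> p 0 = 1 ->
  (forall x, in_disk x -> p x <> 0 ->
     Cmod (x * C_derive p x) * beta <= Theta (Cmod (p x - 1)) * (Cmod x * cr_slope (Cmod x))) ->
  in_disk z -> Cmod (p z - 1) < 2 / 3.
Proof.
  intros Hbeta Hc HH HH0 Hp Hp0 Hineq Hz; unfold in_disk in Hz.
  rewrite analytic_Cder in Hp.
  assert (Hr0 := Cmod_ge_0 z); set (r := Cmod z) in *.
  (* The gap is positive because [|z| < 1]. Half of it gives a strict start, [s 0 > 0], the other
     half a strictly larger derivative; altogether [s 1] is [cr_primitive 1 / beta], still at most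
     [c]. *)
  set (e := (cr_primitive 1 - cr_primitive r) / 2).
  assert (He : 0 < e) by (unfold e; assert (X := cr_primitive_lt r 1 Hr0 Hz); lra).
  set (s := fun t => (cr_primitive (r * t) + e * (1 + t)) / beta).
  set (ds := fun t => (r * cr_slope (r * t) + e) / beta).
  assert (Hds : forall t, is_derive s t (ds t)).
  { intros t; unfold s, ds.
    apply (is_derive_ext (fun t => / beta * (cr_primitive (r * t) + e * (1 + t)))).
    { intros x; apply Rmult_comm. }
    replace ((r * cr_slope (r * t) + e) / beta) with (/ beta * (r * cr_slope (r * t) + e)) by (field; lra).
    apply is_derive_scal, (is_derive_plus (V := R_NormedModule)).
    - apply (is_derive_comp (V := R_NormedModule) cr_primitive (fun t => r * t)); [apply is_derive_cr_primitive|].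
      auto_derive; auto; ring.
    - auto_derive; auto; ring. }
  assert (Hs : forall t, 0 <= t <= 1 -> 0 < s t <= c).
  { intros t Ht.
    assert (X1 : 0 <= cr_primitive (r * t)) by (rewrite <- cr_primitive_0; apply cr_primitive_le; nra).
    assert (X2 : cr_primitive (r * t) <= cr_primitive r) by (apply cr_primitive_le; nra).
    split; [apply Rdiv_lt_0_compat; nra|].
    apply Rle_div_l; auto; unfold e in *; nra. }
  (* Squares are compared, as the modulus itself need not be differentiable where [p = 1]. *)
  set (f := fun t : R => (Re (p (t * z)%C) - 1) ^ 2 + Im (p (t * z)%C) ^ 2 - H (s t) ^ 2).
  set (d := fun t : R => C_derive p (t * z)).
  set (df := fun t : R => 2 * ((Re (p (t * z)%C) - 1) * Re (d t * z)%C + Im (p (t * z)%C) * Im (d t * z)%C)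
     - 2 * H (s t) * (Theta (H (s t)) * ds t)).
  assert (Hin : forall t : R, 0 <= t <= 1 -> Cmod (t * z) = t * r).
  { intros t Ht; rewrite Cmod_mult, Cmod_R, Rabs_right; [auto|lra]. }
  assert (Hd : forall t : R, 0 <= t <= 1 -> Cder p (t * z)%C (d t)).
  { intros t Ht; destruct (Hp (t * z)%C) as [d' D].
    - unfold in_disk; rewrite Hin; nra.
    - unfold d; now rewrite (Cder_C_derive _ _ _ D). }
  assert (Hsqr : forall t : R, (Re (p (t * z)%C) - 1) ^ 2 + Im (p (t * z)%C) ^ 2 = Cmod (p (t * z)%C - 1) ^ 2).
  { intros t; replace (Cmod (p (t * z)%C - 1) ^ 2) with (Cmod (p (t * z)%C - 1) * Cmod (p (t * z)%C - 1)) by ring.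
    rewrite Cmod_sqr, Re_minus, Im_minus, re_RtoC, im_RtoC; ring. }
  assert (Hf1 : f 1 < 0).
  { apply (negative_of_no_upcrossing f df).
    - intros t Ht.
      assert (DR := Cder_ray Re p z (d t) t Re_minus re_scal_l re_le_Cmod (Hd t Ht)).
      assert (DI := Cder_ray Im p z (d t) t Im_minus im_scal_l Im_le_Cmod (Hd t Ht)).
      assert (DH : is_derive (fun t => H (s t)) t (ds t * Theta (H (s t)))).
      { apply (is_derive_comp (V := R_NormedModule)); auto; apply HH; specialize (Hs t Ht); lra. }
      unfold f, df.
      apply (is_derive_ext (fun t : R => ((Re (p (t * z)%C) - 1) * (Re (p (t * z)%C) - 1)
        + Im (p (t * z)%C) * Im (p (t * z)%C)) - H (s t) * H (s t))); [intros; simpl; ring|].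
      replace (2 * ((Re (p (t * z)%C) - 1) * Re (d t * z)%C + Im (p (t * z)%C) * Im (d t * z)%C)
        - 2 * H (s t) * (Theta (H (s t)) * ds t)) with
        (minus (plus ((Re (d t * z)%C - 0) * (Re (p (t * z)%C) - 1) + (Re (p (t * z)%C) - 1) * (Re (d t * z)%C - 0))
          (Im (d t * z)%C * Im (p (t * z)%C) + Im (p (t * z)%C) * Im (d t * z)%C))
          (ds t * Theta (H (s t)) * H (s t) + H (s t) * (ds t * Theta (H (s t)))))
        by (unfold minus, plus, opp; simpl; ring).
      assert (DR' : is_derive (fun t : R => Re (p (t * z)%C) - 1) t (Re (d t * z)%C - 0)).
      { exact (is_derive_minus (V := R_NormedModule) _ (fun _ => 1) t _ _ DR
          (is_derive_const (V := R_NormedModule) 1 t)). }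
      exact (is_derive_minus (V := R_NormedModule) _ _ t _ _
        (is_derive_plus (V := R_NormedModule) _ _ t _ _
           (Derive.is_derive_mult _ _ t _ _ DR' DR') (Derive.is_derive_mult _ _ t _ _ DI DI))
        (Derive.is_derive_mult _ _ t _ _ DH DH)).
    - unfold f; rewrite Hsqr.
      replace (p (0 * z)%C - 1)%C with (RtoC 0).
      2:{ replace (0 * z)%C with (RtoC 0) by ring; rewrite Hp0; ring. }
      rewrite Cmod_0; specialize (Hs 0 ltac:(lra)); specialize (HH0 _ Hs).
      assert (0 < H (s 0) ^ 2) by (apply pow_lt; lra). lra.
    - intros t Ht Hft.
      specialize (Hs t ltac:(lra)); destruct (HH0 _ Hs) as [G0 G1].
      destruct (HH (s t) ltac:(lra)) as [_ HTh].
      assert (E : Cmod (p (t * z)%C - 1) = H (s t)).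
      { unfold f in Hft; rewrite Hsqr in Hft.
        assert (X := Cmod_ge_0 (p (t * z)%C - 1)); nra. }
      (* The hypothesis on [p] speaks only of points where [p <> 0]; at a crossing
         [|p - 1| <= 2/3 < 1] provides this. *)
      assert (Hne : p (t * z)%C <> 0).
      { intros Z; rewrite Z in E; replace (0 - 1)%C with (- (1))%C in E by ring.
        rewrite Cmod_m1 in E; lra. }
      assert (Hi : in_disk (t * z)) by (unfold in_disk; rewrite Hin by lra; nra).
      specialize (Hineq _ Hi Hne); fold (d t) in Hineq; rewrite Hin, E in Hineq by lra.
      replace (Cmod (t * z * d t)) with (t * Cmod (d t * z)) in Hineq.
      2:{ rewrite !Cmod_mult, Cmod_R, Rabs_right by lra; ring. }
      assert (Hdz : Cmod (d t * z) < Theta (H (s t)) * ds t).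
      { unfold ds; apply (Rmult_lt_reg_r (t * beta)); [nra|].
        replace (Theta (H (s t)) * ((r * cr_slope (r * t) + e) / beta) * (t * beta)) with
          (Theta (H (s t)) * (t * r * cr_slope (t * r)) + Theta (H (s t)) * (e * t))
          by (rewrite (Rmult_comm r t); field; lra).
        assert (0 < Theta (H (s t)) * (e * t)) by (apply Rmult_lt_0_compat; nra).
        lra. }
      unfold df.
      assert (Hin' := inner_le_Cmod (p (t * z)%C - 1) (d t * z)).
      rewrite Re_minus, Im_minus, re_RtoC, im_RtoC, E in Hin'.
      assert (H (s t) * Cmod (d t * z) < H (s t) * (Theta (H (s t)) * ds t)) by (apply Rmult_lt_compat_l; auto).
      lra. }
  unfold f in Hf1; rewrite Hsqr in Hf1; replace (1 * z)%C with z in Hf1 by ring.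
  specialize (Hs 1 ltac:(lra)); specialize (HH0 _ Hs).
  assert (X := Cmod_ge_0 (p z - 1)%C); nra.
Qed.

(** * The nephroid *)

Lemma third_Cmod (z : C) : Cmod (z / 3) = Cmod z / 3.
Proof.
  rewrite Cmod_div by (intros E; apply RtoC_inj in E; lra).
  rewrite Cmod_R, Rabs_right; lra.
Qed.

Lemma RtoC_3_neq_0 : RtoC 3 <> 0.
Proof. intros E; apply RtoC_inj in E; lra. Qed.

(* [z |-> u + z^3 / 3] is a contraction of the closed disk of radius [1/3 + |u|];
   its fixed point minimises the distance from [z] to its image. *)
Lemma phi_Ne_surj (u : C) :
  Cmod u < 2 / 3 -> exists z, Cmod z < 1 /\ phi_Ne z = (1 + u)%C.
Proof.
  intros Hu.
  (* [r < 1] is the assumption on [u]; then [|u| + r^3 / 3 <= r], and [r^2] is a contraction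
     constant. *)
  set (r := 1 / 3 + Cmod u).
  assert (Hu0 := Cmod_ge_0 u).
  assert (Hr : 0 <= r < 1) by (unfold r; lra).
  set (T := fun z => (u + z ^ 3 / 3)%C).
  assert (H3 := RtoC_3_neq_0).
  assert (HT : forall z, Cmod z <= r -> Cmod (T z) <= r).
  { intros z Hz; unfold T; eapply Rle_trans; [apply Cmod_triangle|].
    rewrite third_Cmod, Cmod_pow.
    assert (Cmod z ^ 3 <= r ^ 3) by (apply pow_incr; split; [apply Cmod_ge_0|auto]).
    unfold r in *; nra. }
  assert (HL : forall z y, Cmod z <= r -> Cmod y <= r -> Cmod (T z - T y) <= r ^ 2 * Cmod (z - y)).
  { intros z y Hz Hy.
    replace (T z - T y)%C with ((z * z + z * y + y * y) / 3 * (z - y))%C by (unfold T; field; auto).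
    rewrite Cmod_mult; apply Rmult_le_compat_r; [apply Cmod_ge_0|].
    rewrite third_Cmod.
    assert (Z0 := Cmod_ge_0 z); assert (Y0 := Cmod_ge_0 y).
    assert (Cmod (z * z + z * y + y * y) <= Cmod z * Cmod z + Cmod z * Cmod y + Cmod y * Cmod y).
    { eapply Rle_trans; [apply Cmod_triangle|]; rewrite <- !Cmod_mult.
      apply Rplus_le_compat_r, Cmod_triangle. }
    assert (Cmod z * Cmod z <= r * r) by (apply Rmult_le_compat; auto).
    assert (Cmod z * Cmod y <= r * r) by (apply Rmult_le_compat; auto).
    assert (Cmod y * Cmod y <= r * r) by (apply Rmult_le_compat; auto).
    nra. }
  destruct (closed_disk_argmax (fun z => - Cmod (z - T z)) r) as [z0 [Hz0 Hmax]]; [lra| |].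
  - intros z _ eps He.
    assert (Hc : Ccont (fun z => z + - (1) * T z)%C z).
    { apply Ccont_plus; [apply Ccont_id|]; apply Ccont_mult; [apply Ccont_const|].
      apply Ccont_plus; [apply Ccont_const|]; apply Ccont_mult; [|apply Ccont_const].
      apply (Ccont_ext_loc (fun y => y * (y * y))%C _ _ 1); [lra|intros; simpl; ring|].
      repeat apply Ccont_mult; apply Ccont_id. }
    destruct (Hc eps He) as [del [Hdel H]]; exists del; split; auto; intros y Hy.
    specialize (H y Hy).
    replace (y + - (1) * T y - (z + - (1) * T z))%C with ((y - T y) - (z - T z))%C in H by ring.
    assert (H1 := Cmod_triangle_rev (y - T y) (z - T z)).
    assert (H2 := Cmod_triangle_rev (z - T z) (y - T y)).
    rewrite (Cmod_minus_sym (z - T z)) in H2.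
    apply Rabs_lt_between; lra.
  - assert (HTz := HT z0 Hz0).
    assert (H1 := Hmax (T z0) HTz); assert (H2 := HL z0 (T z0) Hz0 HTz).
    assert (D0 : Cmod (z0 - T z0) = 0).
    { assert (D := Cmod_ge_0 (z0 - T z0)); cbv beta in H1; assert (r ^ 2 < 1) by nra; nra. }
    apply Cmod_eq_0, Ceq_minus in D0.
    exists z0; split; [lra|]; unfold phi_Ne.
    transitivity (1 + T z0 - z0 ^ 3 / 3)%C; [rewrite <- D0; reflexivity|unfold T; field; auto].
Qed.

(** The difference quotient is [1 - (a^2 + a b + b^2) / 3]. Using only [|b| < 1] leaves a positive
    constant depending on [a] alone, hence continuity of an inverse at [phi_Ne a]. *)
Lemma phi_Ne_expansion (a b : C) :
  Cmod a < 1 -> Cmod b < 1 ->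
  (2 - Cmod a - Cmod a ^ 2) / 3 * Cmod (b - a) <= Cmod (phi_Ne b - phi_Ne a).
Proof.
  intros Ha Hb; assert (H3 := RtoC_3_neq_0).
  replace (phi_Ne b - phi_Ne a)%C with ((1 - (a * a + a * b + b * b) / 3) * (b - a))%C
    by (unfold phi_Ne; field; auto).
  rewrite Cmod_mult; apply Rmult_le_compat_r; [apply Cmod_ge_0|].
  eapply Rle_trans; [|apply Cmod_triangle_rev]; rewrite Cmod_1, third_Cmod.
  assert (A0 := Cmod_ge_0 a); assert (B0 := Cmod_ge_0 b).
  assert (Cmod (a * a + a * b + b * b) <= Cmod a * Cmod a + Cmod a * Cmod b + Cmod b * Cmod b).
  { eapply Rle_trans; [apply Cmod_triangle|]; rewrite <- !Cmod_mult.
    apply Rplus_le_compat_r, Cmod_triangle. }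
  nra.
Qed.

Lemma Cder_phi_Ne (z : C) : Cder phi_Ne z (1 - z * z).
Proof.
  assert (H3 := RtoC_3_neq_0).
  apply (Cder_ext_loc (fun y => 1 + (y + - / 3 * (y * (y * y))))%C _ _ _ 1); [lra| |].
  { intros y _; unfold phi_Ne; field; auto. }
  apply (Cder_eq _ _ (0 + (1 + - / 3 * (1 * (z * z) + z * (1 * z + z * 1))))%C); [field; auto|].
  apply Cder_plus; [apply Cder_const|]; apply (Cder_plus (fun y => y)); [apply Cder_id|].
  apply Cder_scal, (Cder_mult (fun y => y) (fun y => y * y)%C); [apply Cder_id|].
  apply (Cder_mult (fun y => y) (fun y => y)); apply Cder_id.
Qed.

(** Preimages are selected by choice. [phi_Ne_expansion] makes the selection continuous, and then
    [Cder_inverse] makes it differentiable, since [1 - z^2] has no zero in the disk. *)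
Lemma phi_Ne_inverse_exists :
  exists g : C -> C, forall u, Cmod (u - 1) < 2 / 3 ->
    Cmod (g u) < 1 /\ phi_Ne (g u) = u /\ exists d, Cder g u d.
Proof.
  (* The condition on [u] sits under the existential, so that choice yields a total function. *)
  assert (Hex : forall u, exists z, Cmod (u - 1) < 2 / 3 -> Cmod z < 1 /\ phi_Ne z = u).
  { intros u; destruct (Rlt_dec (Cmod (u - 1)) (2 / 3)) as [H|H]; [|now exists 0].
    destruct (phi_Ne_surj _ H) as [z [Hz E]]; exists z; intros _; split; auto.
    rewrite E; ring. }
  set (g := fun u => proj1_sig (constructive_indefinite_description _ (Hex u))).
  assert (Hg : forall u, Cmod (u - 1) < 2 / 3 -> Cmod (g u) < 1 /\ phi_Ne (g u) = u).
  { intros u; exact (proj2_sig (constructive_indefinite_description _ (Hex u))). }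
  clearbody g; exists g; intros u Hu; destruct (Hg u Hu) as [Hgu E]; split; [|split]; auto.
  assert (Hr : forall y, Cmod (y - u) < 2 / 3 - Cmod (u - 1) -> Cmod (y - 1) < 2 / 3).
  { intros y Hy; replace (y - 1)%C with ((y - u) + (u - 1))%C by ring.
    eapply Rle_lt_trans; [apply Cmod_triangle|lra]. }
  assert (G0 := Cmod_ge_0 (g u)).
  set (k := (2 - Cmod (g u) - Cmod (g u) ^ 2) / 3).
  assert (Hk : 0 < k) by (unfold k; nra).
  exists (/ (1 - g u * g u))%C.
  apply (Cder_inverse phi_Ne g u _ (2 / 3 - Cmod (u - 1))); [lra| | | |].
  - intros y Hy; now apply Hg, Hr.
  - intros eps He; exists (Rmin (2 / 3 - Cmod (u - 1)) (k * eps)); split; [apply Rmin_pos; nra|].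
    intros y Hy.
    assert (Hy1 := Rlt_le_trans _ _ _ Hy (Rmin_l _ _)).
    assert (Hy2 := Rlt_le_trans _ _ _ Hy (Rmin_r _ _)).
    destruct (Hg y (Hr y Hy1)) as [Hgy Ey].
    assert (X := phi_Ne_expansion (g u) (g y) Hgu Hgy); fold k in X; rewrite E, Ey in X.
    apply (Rmult_lt_reg_l k); lra.
  - apply Cder_phi_Ne.
  - intros Z; assert (Hm : Cmod (g u * g u) = 1).
    { replace (g u * g u)%C with (1 - (1 - g u * g u))%C by ring.
      rewrite Z; replace (1 - 0)%C with (RtoC 1) by ring; apply Cmod_1. }
    rewrite Cmod_mult in Hm; nra.
Qed.

Lemma subordinate_phi_Ne (p : C -> C) :
  analytic_in_disk p -> p 0 = 1 -> (forall z, in_disk z -> Cmod (p z - 1) < 2 / 3) ->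
  subordinate p phi_Ne.
Proof.
  intros Hp Hp0 Hb; destruct phi_Ne_inverse_exists as [g Hg].
  split; [auto|split].
  - apply analytic_Cder; intros z _; eexists; apply Cder_phi_Ne.
  - exists (fun z => g (p z)); split; [|split; [|split]].
    + rewrite analytic_Cder in *; intros z Hz.
      destruct (Hp z Hz) as [d D]; destruct (Hg _ (Hb z Hz)) as [_ [_ [d' D']]].
      exists (d' * d)%C; now apply Cder_comp.
    + rewrite Hp0; destruct (Hg 1) as [H1 [H2 _]].
      { replace (1 - 1)%C with (RtoC 0) by ring; rewrite Cmod_0; lra. }
      (* Since [phi_Ne 0 = 1], expansion from [0] forces the chosen preimage of [1] to be [0]. *)
      assert (X := phi_Ne_expansion 0 (g 1) ltac:(rewrite Cmod_0; lra) H1).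
      rewrite H2, Cmod_0 in X.
      replace (1 - phi_Ne 0)%C with (RtoC 0) in X.
      2:{ unfold phi_Ne; field; apply RtoC_3_neq_0. }
      replace (g 1 - 0)%C with (g 1) in X by ring; rewrite Cmod_0 in X.
      apply Cmod_eq_0; assert (Y := Cmod_ge_0 (g 1)); lra.
    + intros z Hz; now apply Hg, Hb.
    + intros z Hz; symmetry; now apply Hg, Hb.
Qed.

(** * The three implications *)

Lemma cr_primitive_1_pos : 0 < cr_primitive 1.
Proof. rewrite <- cr_primitive_0; apply cr_primitive_lt; lra. Qed.

Lemma ln_5_3_pos : 0 < ln (5 / 3).
Proof. rewrite <- ln_1; apply ln_increasing; lra. Qed.

Lemma beta_a_eq : beta_a = 3 / 2 * cr_primitive 1.
Proof. unfold beta_a; rewrite cr_primitive_1; field. Qed.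

Lemma beta_b_eq : beta_b = cr_primitive 1 / ln (5 / 3).
Proof.
  unfold beta_b; rewrite cr_primitive_1; field; apply Rgt_not_eq, ln_5_3_pos.
Qed.

Lemma beta_c_eq : beta_c = 5 / 2 * cr_primitive 1.
Proof. unfold beta_c; rewrite cr_primitive_1; field. Qed.

Lemma subordinate_phi_cr_growth (f : C -> C) (z : C) :
  subordinate f phi_cr -> in_disk z -> Cmod (f z - 1) <= Cmod z * cr_slope (Cmod z).
Proof.
  intros [_ [_ [w [Hw [H0 [H1 E]]]]]] Hz; rewrite (E z Hz), cr_slope_id.
  apply phi_cr_growth; [now apply schwarz_lemma|exact Hz].
Qed.

Lemma Cmod_le_1_plus (x : C) : Cmod x <= 1 + Cmod (x - 1).
Proof.
  assert (H := Cmod_triangle 1 (x - 1)); rewrite Cmod_1 in H.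
  replace (1 + (x - 1))%C with x in H by ring; auto.
Qed.

Lemma phi_cr_implies_phi_Ne_a (p : C -> C) (beta : R) :
  analytic_in_disk p -> p 0 = 1 -> beta_a <= beta ->
  subordinate (Psi_a p beta) phi_cr -> subordinate p phi_Ne.
Proof.
  intros Hp Hp0 Hb Hs; rewrite beta_a_eq in Hb; assert (HL := cr_primitive_1_pos).
  apply subordinate_phi_Ne; auto; intros z Hz.
  (* Here [zp'] is bounded with no factor [p]: [Theta] is constant and [H s = s] reaches [2/3] at
     [s = 2/3]. *)
  apply (ray_comparison p beta (2 / 3) (fun _ => 1) (fun s => s)); auto; try lra.
  - intros s _; split; [exact (is_derive_id (K := R_AbsRing) s)|lra].
  - intros x Hx _; rewrite Rmult_1_l.
    eapply Rle_trans; [|exact (subordinate_phi_cr_growth _ _ Hs Hx)].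
    unfold Psi_a; replace (1 + beta * (x * C_derive p x) - 1)%C with (beta * (x * C_derive p x))%C by ring.
    rewrite (Cmod_mult beta), Cmod_R, Rabs_right; lra.
Qed.

Lemma phi_cr_implies_phi_Ne_b (p : C -> C) (beta : R) :
  analytic_in_disk p -> p 0 = 1 -> beta_b <= beta ->
  subordinate (Psi_b p beta) phi_cr -> subordinate p phi_Ne.
Proof.
  intros Hp Hp0 Hb Hs; rewrite beta_b_eq in Hb; assert (HL := cr_primitive_1_pos).
  assert (Hln := ln_5_3_pos).
  assert (Hbeta : 0 < beta).
  { eapply Rlt_le_trans; [|exact Hb]; now apply Rdiv_lt_0_compat. }
  apply subordinate_phi_Ne; auto; intros z Hz.
  (* The factor [|p| <= 1 + |p - 1|] gives [Theta]. The solution of [y' = 1 + y] from [0] is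
     [exp s - 1], which reaches [2/3] at [ln (5/3)]. *)
  apply (ray_comparison p beta (ln (5 / 3)) (fun x => 1 + x) (fun s => exp s - 1)); auto.
  - apply Rle_div_l in Hb; lra.
  - intros s Hs0; assert (X := exp_pos s); split; [|lra].
    auto_derive; auto; ring.
  - intros s Hs0; split.
    + assert (exp 0 < exp s) by (apply exp_increasing; lra); rewrite exp_0 in *; lra.
    + assert (exp s <= exp (ln (5 / 3))).
      { destruct (proj2 Hs0) as [Hlt| ->]; [left; now apply exp_increasing|lra]. }
      rewrite exp_ln in *; lra.
  - intros x Hx Hne.
    assert (G := subordinate_phi_cr_growth _ _ Hs Hx); unfold Psi_b in G.
    set (B := Cmod x * cr_slope (Cmod x)) in *.
    replace (1 + beta * (x * C_derive p x / p x) - 1)%C with (beta * ((x * C_derive p x) / p x))%C in G by ring.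
    rewrite (Cmod_mult beta), Cmod_R, Rabs_right, Cmod_div in G by (auto; lra).
    assert (Hpx : 0 < Cmod (p x)) by now apply Cmod_gt_0.
    assert (H1 := Cmod_le_1_plus (p x)).
    apply Rle_trans with (Cmod (p x) * B).
    + apply Rle_trans with (Cmod (p x) * (beta * (Cmod (x * C_derive p x) / Cmod (p x)))).
      * right; field; lra.
      * apply Rmult_le_compat_l; lra.
    + apply Rmult_le_compat_r; auto; eapply Rle_trans; [|exact G].
      apply Rmult_le_pos; [lra|]; apply Rdiv_le_0_compat; auto; apply Cmod_ge_0.
Qed.

Lemma phi_cr_implies_phi_Ne_c (p : C -> C) (beta : R) :
  analytic_in_disk p -> p 0 = 1 -> beta_c <= beta ->
  subordinate (Psi_c p beta) phi_cr -> subordinate p phi_Ne.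
Proof.
  intros Hp Hp0 Hb Hs; rewrite beta_c_eq in Hb; assert (HL := cr_primitive_1_pos).
  apply subordinate_phi_Ne; auto; intros z Hz.
  (* With [|p|^2] in place of [|p|] the equation is [y' = (1 + y)^2]; its solution [s / (1 - s)]
     from [0] reaches [2/3] at [2/5]. *)
  apply (ray_comparison p beta (2 / 5) (fun x => (1 + x) ^ 2) (fun s => s / (1 - s))); auto; try lra.
  - intros s Hs0; split.
    + auto_derive; [lra|field; lra].
    + apply pow_lt.
      assert (0 <= s / (1 - s)); [apply Rdiv_le_0_compat; lra|lra].
  - intros s Hs0; split; [apply Rdiv_lt_0_compat; lra|].
    apply Rle_div_l; lra.
  - intros x Hx Hne.
    assert (G := subordinate_phi_cr_growth _ _ Hs Hx); unfold Psi_c in G.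
    set (B := Cmod x * cr_slope (Cmod x)) in *.
    replace (1 + beta * (x * C_derive p x / p x ^ 2) - 1)%C with (beta * ((x * C_derive p x) / p x ^ 2))%C in G by ring.
    rewrite (Cmod_mult beta), Cmod_R, Rabs_right, Cmod_div, Cmod_pow in G by (try apply Cpow_nz; auto; lra).
    assert (Hpx : 0 < Cmod (p x)) by now apply Cmod_gt_0.
    assert (H1 := Cmod_le_1_plus (p x)).
    assert (Hp2 : 0 < Cmod (p x) ^ 2) by now apply pow_lt.
    apply Rle_trans with (Cmod (p x) ^ 2 * B).
    + apply Rle_trans with (Cmod (p x) ^ 2 * (beta * (Cmod (x * C_derive p x) / Cmod (p x) ^ 2))).
      * right; field; lra.
      * apply Rmult_le_compat_l; lra.
    + apply Rmult_le_compat_r; [|apply pow_incr; lra]; eapply Rle_trans; [|exact G].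
      apply Rmult_le_pos; [lra|]; apply Rdiv_le_0_compat; auto; apply Cmod_ge_0.
Qed.

(** * Sharpness *)

Lemma Re_Csqrt_pos (z : C) : 0 < Re z -> 0 < Re (Csqrt z).
Proof.
  intros Hz; apply sqrt_lt_R0; assert (H := Cmod_ge_0 z); lra.
Qed.

Lemma Re_pos_neq_0 (z : C) : 0 < Re z -> z <> 0.
Proof. intros Hz E; rewrite E, re_RtoC in Hz; lra. Qed.

Lemma Re_pos_near (z y : C) : Cmod (y - z) < Re z -> 0 < Re y.
Proof.
  intros H; assert (H' := re_le_Cmod (y - z)); rewrite Re_minus in H'.
  apply Rabs_le_between in H'; lra.
Qed.

(** In [y - z = (Csqrt y - Csqrt z) (Csqrt y + Csqrt z)] the last factor has modulus at least
    [Re (Csqrt z)], since roots have nonnegative real part. *)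
Lemma Ccont_Csqrt (z : C) : 0 < Re z -> Ccont Csqrt z.
Proof.
  intros Hz eps He; assert (Hs := Re_Csqrt_pos z Hz).
  exists (eps * Re (Csqrt z)); split; [now apply Rmult_lt_0_compat|]; intros y Hy.
  assert (E : (y - z)%C = ((Csqrt y - Csqrt z) * (Csqrt y + Csqrt z))%C).
  { rewrite <- (Csqrt_sqr y) at 1; rewrite <- (Csqrt_sqr z) at 1; ring. }
  rewrite E, Cmod_mult in Hy.
  assert (Hge : Re (Csqrt z) <= Cmod (Csqrt y + Csqrt z)).
  { eapply Rle_trans; [|apply Re_le_Cmod]; rewrite re_plus.
    assert (X := Csqrt_Re_ge_0 y); lra. }
  assert (X := Cmod_ge_0 (Csqrt y - Csqrt z)); nra.
Qed.

Lemma Cder_Csqrt (z : C) : 0 < Re z -> Cder Csqrt z (/ (2 * Csqrt z)).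
Proof.
  intros Hz; assert (Hs := Re_pos_neq_0 _ (Re_Csqrt_pos z Hz)).
  apply (Cder_inverse (fun y => y * y)%C Csqrt z _ 1); [lra| | | |].
  - intros y _; apply Csqrt_sqr.
  - now apply Ccont_Csqrt.
  - apply (Cder_eq _ _ (1 * Csqrt z + Csqrt z * 1)%C); [ring|].
    apply (Cder_mult (fun y => y) (fun y => y)); apply Cder_id.
  - apply Cmult_neq_0; auto; intros E; apply RtoC_inj in E; lra.
Qed.

(** The principal logarithm on the right half-plane, where the arctangent gives the argument. *)
Definition Clog (z : C) : C := (RtoC (ln (Cmod z)) + Ci * RtoC (atan (Im z * / Re z)))%C.

Lemma Cexp_Clog (z : C) : 0 < Re z -> Cexp (Clog z) = z.
Proof.
  intros Hz; assert (Hm : 0 < Cmod z) by now apply Cmod_gt_0, Re_pos_neq_0.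
  assert (Hre : Re (Clog z) = ln (Cmod z)) by (unfold Clog, Re, Im; simpl; ring).
  assert (Him : Im (Clog z) = atan (Im z * / Re z)) by (unfold Clog, Re, Im; simpl; ring).
  assert (HS : sqrt (1 + (Im z * / Re z)²) = Cmod z / Re z).
  { replace (1 + (Im z * / Re z)²) with ((Cmod z / Re z)²).
    - apply sqrt_Rsqr; left; now apply Rdiv_lt_0_compat.
    - assert (H := Cmod_sqr z); unfold Rsqr; apply (Rmult_eq_reg_r (Re z * Re z)); [|nra].
      transitivity (Cmod z * Cmod z); [field; lra|rewrite H; field; lra]. }
  unfold Cexp; rewrite Hre, Him, exp_ln, cos_atan, sin_atan, HS by auto.
  transitivity (Re z, Im z); [f_equal; field; lra|now destruct z].
Qed.

Lemma Ccont_real_comp (h : R -> R) (phi : C -> R) (z : C) :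
  continuous h (phi z) -> Ccont (fun y => RtoC (phi y)) z ->
  Ccont (fun y => RtoC (h (phi y))) z.
Proof.
  intros Hh Hphi eps He.
  apply filterlim_locally with (eps := mkposreal eps He) in Hh; destruct Hh as [d1 H1].
  destruct (Hphi d1 (cond_pos d1)) as [del [Hdel H]]; exists del; split; auto; intros y Hy.
  specialize (H y Hy); rewrite <- RtoC_minus, Cmod_R in *; exact (H1 _ H).
Qed.

Lemma Ccont_of_1_Lipschitz (phi : C -> R) (z : C) :
  (forall u v, Rabs (phi u - phi v) <= Cmod (u - v)) -> Ccont (fun y => RtoC (phi y)) z.
Proof.
  intros H eps He; exists eps; split; auto; intros y Hy.
  rewrite <- RtoC_minus, Cmod_R; eapply Rle_lt_trans; [apply H|exact Hy].
Qed.

Lemma Ccont_Clog (z : C) : 0 < Re z -> Ccont Clog z.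
Proof.
  intros Hz; assert (Hm : 0 < Cmod z) by now apply Cmod_gt_0, Re_pos_neq_0.
  apply Ccont_plus; [|apply Ccont_mult; [apply Ccont_const|]].
  - apply Ccont_real_comp; [now apply continuous_ln|]; apply Ccont_of_1_Lipschitz.
    intros u v; apply Rabs_le_between.
    assert (H1 := Cmod_triangle_rev u v); assert (H2 := Cmod_triangle_rev v u).
    rewrite Cmod_minus_sym in H2; lra.
  - apply (Ccont_real_comp atan (fun y => Im y * / Re y)); [apply continuous_atan|].
    apply (Ccont_ext_loc (fun y => RtoC (Im y) * RtoC (/ Re y))%C _ _ 1); [lra| |].
    + intros y _; now rewrite RtoC_mult.
    + apply Ccont_mult; [|apply (Ccont_real_comp Rinv); [apply continuous_Rinv; lra|]];
        apply Ccont_of_1_Lipschitz; intros u v; [rewrite <- Im_minus; apply Im_le_Cmod|].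
      rewrite <- Re_minus; apply re_le_Cmod.
Qed.

Lemma Cder_Clog (z : C) : 0 < Re z -> Cder Clog z (/ z).
Proof.
  intros Hz; apply (Cder_inverse Cexp Clog z _ (Re z)); auto.
  - intros y Hy; now apply Cexp_Clog, (Re_pos_near z).
  - now apply Ccont_Clog.
  - apply (Cder_eq _ _ (Cexp (Clog z))); [now apply Cexp_Clog|apply Cder_Cexp].
  - now apply Re_pos_neq_0.
Qed.

Lemma Re_1_plus_sqr_pos (z : C) : in_disk z -> 0 < Re (1 + z ^ 2).
Proof.
  intros Hz; rewrite re_plus, re_RtoC.
  assert (H := re_le_Cmod (z ^ 2)); rewrite Cmod_pow in H; apply Rabs_le_between in H.
  assert (H0 := Cmod_ge_0 z); unfold in_disk in Hz; nra.
Qed.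

Lemma Cder_sqrt_1_plus_sqr (z : C) :
  in_disk z -> Cder (fun y => Csqrt (1 + y ^ 2)) z (z / Csqrt (1 + z ^ 2)).
Proof.
  intros Hz; assert (Hp := Re_1_plus_sqr_pos z Hz).
  assert (Hs := Re_pos_neq_0 _ (Re_Csqrt_pos _ Hp)).
  assert (H2 : RtoC 2 <> 0) by (intros E; apply RtoC_inj in E; lra).
  apply (Cder_eq _ _ (/ (2 * Csqrt (1 + z ^ 2)) * (0 + (1 * z + z * 1)))%C); [field; auto|].
  apply (Cder_comp Csqrt); [now apply Cder_Csqrt|].
  apply (Cder_ext_loc (fun y => 1 + y * y)%C _ _ _ 1); [lra|intros; simpl; ring|].
  apply Cder_plus; [apply Cder_const|].
  apply (Cder_mult (fun y => y) (fun y => y)); apply Cder_id.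
Qed.

Lemma analytic_phi_cr : analytic_in_disk phi_cr.
Proof.
  apply analytic_Cder; intros z Hz; eexists; unfold phi_cr.
  apply (Cder_plus (fun y => y)); [apply Cder_id|now apply Cder_sqrt_1_plus_sqr].
Qed.

(** The analytic extension of [cr_primitive] to the disk. The argument of [Clog] has real part at
    least [1]. *)
Definition Ccr_primitive (z : C) : C :=
  (z + (Csqrt (1 + z ^ 2) + (RtoC (ln 2 - 1) + - (1) * Clog (1 + Csqrt (1 + z ^ 2)))))%C.

Definition Ccr_slope (z : C) : C := (1 + z / (1 + Csqrt (1 + z ^ 2)))%C.

Lemma Re_1_plus_sqrt_pos (z : C) : 0 < Re (1 + Csqrt z).
Proof. rewrite re_plus, re_RtoC; assert (H := Csqrt_Re_ge_0 z); lra. Qed.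

Lemma Cder_Ccr_primitive (z : C) : in_disk z -> Cder Ccr_primitive z (Ccr_slope z).
Proof.
  intros Hz; assert (Hp := Re_1_plus_sqr_pos z Hz).
  assert (Hs := Re_pos_neq_0 _ (Re_Csqrt_pos _ Hp)).
  assert (Hs1 := Re_pos_neq_0 _ (Re_1_plus_sqrt_pos (1 + z ^ 2))).
  assert (D := Cder_sqrt_1_plus_sqr z Hz).
  set (s := Csqrt (1 + z ^ 2)) in *.
  apply (Cder_eq _ _ (1 + (z / s + (0 + - (1) * (/ (1 + s) * (0 + z / s)))))%C).
  { unfold Ccr_slope; fold s; field; auto. }
  apply (Cder_plus (fun y => y)); [apply Cder_id|].
  apply Cder_plus; [exact D|]; apply Cder_plus; [apply Cder_const|].
  apply Cder_scal, (Cder_comp Clog); [apply Cder_Clog, Re_1_plus_sqrt_pos|].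
  apply Cder_plus; [apply Cder_const|exact D].
Qed.

Lemma Ccr_slope_id (z : C) : (z * Ccr_slope z)%C = (phi_cr z - 1)%C.
Proof.
  assert (Hs1 := Re_pos_neq_0 _ (Re_1_plus_sqrt_pos (1 + z ^ 2))).
  assert (E := Csqrt_sqr (1 + z ^ 2)).
  unfold Ccr_slope, phi_cr; set (s := Csqrt (1 + z ^ 2)) in *.
  transitivity (z + (s * s - 1) / (1 + s))%C; [rewrite E; field; auto|field; auto].
Qed.

Lemma Csqrt_R (x : R) : 0 <= x -> Csqrt x = sqrt x.
Proof.
  intros Hx; unfold Csqrt; rewrite re_RtoC, im_RtoC, Cmod_R, Rabs_right by lra.
  destruct (Rlt_dec 0 0) as [H|_]; [lra|].
  replace ((x + x) / 2) with x by field; replace ((x - x) / 2) with 0 by field.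
  now rewrite sqrt_0.
Qed.

Lemma Clog_R (x : R) : 0 < x -> Clog x = ln x.
Proof.
  intros Hx; unfold Clog; rewrite re_RtoC, im_RtoC, Cmod_R, Rabs_right by lra.
  rewrite Rmult_0_l, atan_0; ring.
Qed.

Lemma Ccr_primitive_R (x : R) : Ccr_primitive x = cr_primitive x.
Proof.
  assert (H := sqrt_pos (1 + x ^ 2)).
  unfold Ccr_primitive, cr_primitive.
  rewrite <- RtoC_pow, <- (RtoC_plus 1 (x ^ 2)), Csqrt_R by nra.
  rewrite <- RtoC_plus, Clog_R by lra.
  rewrite <- RtoC_opp, <- RtoC_mult, <- !RtoC_plus; f_equal; ring.
Qed.

Lemma Ccr_primitive_0 : Ccr_primitive 0 = 0.
Proof. now rewrite Ccr_primitive_R, cr_primitive_0. Qed.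

(** With [w = a + i b], a real value means [b (3 - 3 a^2 + b^2) = 0], hence [b = 0]; then
    [5 - 3 x = (1 - a)^2 (a + 2) > 0]. *)
Lemma phi_Ne_real_lt (w : C) (x : R) : Cmod w < 1 -> phi_Ne w = x -> x < 5 / 3.
Proof.
  intros Hw E; assert (Hm := Cmod_sqr w); assert (Hp := Cmod_ge_0 w).
  assert (H3 := RtoC_3_neq_0).
  assert (E' : (3 * (w - RtoC (x - 1)) = w * (w * w))%C).
  { rewrite <- E, RtoC_minus || rewrite RtoC_minus, <- E; unfold phi_Ne; field; auto. }
  destruct w as [a b]; unfold Re, Im, Cminus, Cplus, Copp, Cmult, RtoC in *; simpl in *.
  injection E'; clear E'; intros Eim Ere.
  set (m := Cmod (a, b)) in *; clearbody m.
  assert (Hab : a * a + b * b < 1) by nra.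
  assert (Hb : b * (3 - 3 * (a * a) + b * b) = 0) by lra.
  assert (Hb0 : b = 0).
  { apply Rmult_integral in Hb; destruct Hb as [Hb|Hb]; [auto|nra]. }
  subst b; assert (a < 1) by nra.
  assert (Hx : 3 * (x - 1) = 3 * a - a * a * a) by lra.
  assert (0 < (1 - a) * (1 - a) * (a + 2)) by (repeat apply Rmult_lt_0_compat; nra).
  nra.
Qed.

Lemma not_subordinate_phi_Ne (p : C -> C) (r x : R) :
  Rabs r < 1 -> p r = x -> 5 / 3 <= x -> ~ subordinate p phi_Ne.
Proof.
  intros Hr Hpr Hx [_ [_ [w [_ [_ [Hw E]]]]]].
  assert (Hin : in_disk r) by (unfold in_disk; now rewrite Cmod_R).
  rewrite E in Hpr by auto.
  assert (X := phi_Ne_real_lt _ _ (Hw _ Hin) Hpr); lra.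
Qed.

(** The point [1] lies outside the disk, so counterexamples need an inequality that already holds at
    some [r < 1]. *)
Lemma cr_primitive_near_1 (K : R) :
  K < cr_primitive 1 -> exists r, 0 < r < 1 /\ K < cr_primitive r.
Proof.
  intros HK.
  assert (Hc : continuous cr_primitive 1).
  { apply (ex_derive_continuous (V := R_NormedModule)); eexists; apply is_derive_cr_primitive. }
  assert (He : 0 < cr_primitive 1 - K) by lra.
  apply filterlim_locally with (eps := mkposreal _ He) in Hc; destruct Hc as [del Hd].
  assert (Hdel := cond_pos del).
  set (r := Rmax (1 / 2) (1 - del / 2)).
  assert (1 / 2 <= r) by apply Rmax_l; assert (1 - del / 2 <= r) by apply Rmax_r.
  assert (r < 1) by (apply Rmax_lub_lt; lra).
  exists r; split; [lra|].
  assert (Hr : Rabs (r - 1) < del) by (apply Rabs_lt_between; lra).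
  assert (X : Rabs (cr_primitive r - cr_primitive 1) < cr_primitive 1 - K) by exact (Hd r Hr).
  apply Rabs_lt_between in X; lra.
Qed.

(** * Extremal functions *)

Lemma subordinate_of_eq (f g : C -> C) :
  analytic_in_disk g -> (forall z, in_disk z -> f z = g z) -> subordinate f g.
Proof.
  intros Hg E; split; [|split; auto].
  - rewrite analytic_Cder in *; intros z Hz; destruct (Hg z Hz) as [d D]; exists d.
    assert (Hz' : Cmod z < 1) by exact Hz.
    apply (Cder_ext_loc g _ _ _ (1 - Cmod z)); [lra| |auto].
    intros y Hy; symmetry; apply E; unfold in_disk.
    replace y with ((y - z) + z)%C by ring; eapply Rle_lt_trans; [apply Cmod_triangle|lra].
  - exists (fun z => z); repeat split; auto.
    apply analytic_Cder; intros z _; eexists; apply Cder_id.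
Qed.

(** The three extremal functions solve [Psi p beta = phi_cr] with [p 0 = 1]: since [z] times the
    derivative of [Ccr_primitive] is [phi_cr - 1], the functions [p - 1], [log p] and [1 - 1 / p]
    respectively equal [Ccr_primitive / beta]. *)
Definition extremal_a (beta : R) (z : C) : C := (1 + RtoC (/ beta) * Ccr_primitive z)%C.

Definition extremal_b (beta : R) (z : C) : C := Cexp (RtoC (/ beta) * Ccr_primitive z).

Definition extremal_c (beta : R) (z : C) : C := (/ (1 + RtoC (- / beta) * Ccr_primitive z))%C.

Lemma extremal_a_spec (beta : R) :
  0 < beta -> analytic_in_disk (extremal_a beta) /\ extremal_a beta 0 = 1 /\
    subordinate (Psi_a (extremal_a beta) beta) phi_cr.
Proof.
  intros Hb.
  assert (HbC : RtoC beta <> 0) by (intros X; apply RtoC_inj in X; lra).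
  assert (D : forall z, in_disk z -> Cder (extremal_a beta) z (RtoC (/ beta) * Ccr_slope z)).
  { intros z Hz; apply (Cder_eq _ _ (0 + RtoC (/ beta) * Ccr_slope z)%C); [ring|].
    apply Cder_plus; [apply Cder_const|now apply Cder_scal, Cder_Ccr_primitive]. }
  split; [|split].
  - apply analytic_Cder; eauto.
  - unfold extremal_a; rewrite Ccr_primitive_0; ring.
  - apply subordinate_of_eq; [apply analytic_phi_cr|]; intros z Hz.
    unfold Psi_a; rewrite (Cder_C_derive _ _ _ (D z Hz)), RtoC_inv by lra.
    transitivity (1 + z * Ccr_slope z)%C; [field; auto|rewrite Ccr_slope_id; ring].
Qed.

Lemma extremal_b_spec (beta : R) :
  0 < beta -> analytic_in_disk (extremal_b beta) /\ extremal_b beta 0 = 1 /\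
    subordinate (Psi_b (extremal_b beta) beta) phi_cr.
Proof.
  intros Hb.
  assert (HbC : RtoC beta <> 0) by (intros X; apply RtoC_inj in X; lra).
  assert (D : forall z, in_disk z ->
    Cder (extremal_b beta) z (extremal_b beta z * (RtoC (/ beta) * Ccr_slope z))).
  { intros z Hz; apply (Cder_comp Cexp); [apply Cder_Cexp|].
    now apply Cder_scal, Cder_Ccr_primitive. }
  split; [|split].
  - apply analytic_Cder; eauto.
  - unfold extremal_b; rewrite Ccr_primitive_0, Cmult_0_r; apply Cexp_0.
  - apply subordinate_of_eq; [apply analytic_phi_cr|]; intros z Hz.
    assert (He : extremal_b beta z <> 0) by apply Cexp_neq_0.
    unfold Psi_b; rewrite (Cder_C_derive _ _ _ (D z Hz)), RtoC_inv by lra.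
    transitivity (1 + z * Ccr_slope z)%C; [field; auto|rewrite Ccr_slope_id; ring].
Qed.

(** The bound from (a), applied to its own extremal function at the threshold [b]: there
    [|p - 1| < 2/3] reads [|Ccr_primitive z| < cr_primitive 1]. It keeps [extremal_c] free of
    poles. *)
Lemma Cmod_Ccr_primitive (z : C) : in_disk z -> Cmod (Ccr_primitive z) < cr_primitive 1.
Proof.
  intros Hz; assert (HL := cr_primitive_1_pos).
  set (b := 3 / 2 * cr_primitive 1).
  assert (Hb : 0 < b) by (unfold b; lra).
  assert (HbC : RtoC b <> 0) by (intros X; apply RtoC_inj in X; lra).
  destruct (extremal_a_spec b Hb) as [Ha [H0 Hs]].
  assert (X : Cmod (extremal_a b z - 1) < 2 / 3).
  { apply (ray_comparison (extremal_a b) b (2 / 3) (fun _ => 1) (fun s => s)); auto; try (unfold b; lra).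
    - intros s _; split; [exact (is_derive_id (K := R_AbsRing) s)|lra].
    - intros x Hx _; rewrite Rmult_1_l.
      eapply Rle_trans; [|exact (subordinate_phi_cr_growth _ _ Hs Hx)].
      unfold Psi_a.
      replace (1 + b * (x * C_derive (extremal_a b) x) - 1)%C
        with (b * (x * C_derive (extremal_a b) x))%C by ring.
      rewrite (Cmod_mult b), Cmod_R, Rabs_right; lra. }
  unfold extremal_a in X.
  replace (1 + RtoC (/ b) * Ccr_primitive z - 1)%C with (RtoC (/ b) * Ccr_primitive z)%C in X by ring.
  rewrite Cmod_mult, Cmod_R, Rabs_right in X by (left; now apply Rinv_0_lt_compat).
  apply (Rmult_lt_compat_l b) in X; auto.
  rewrite <- Rmult_assoc, Rinv_r in X by lra; unfold b in X; lra.
Qed.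

Lemma extremal_c_spec (beta : R) :
  cr_primitive 1 <= beta -> analytic_in_disk (extremal_c beta) /\ extremal_c beta 0 = 1 /\
    subordinate (Psi_c (extremal_c beta) beta) phi_cr.
Proof.
  intros Hb; assert (HL := cr_primitive_1_pos).
  assert (HbC : RtoC beta <> 0) by (intros X; apply RtoC_inj in X; lra).
  (* A zero would be a point with [Ccr_primitive z = beta], too large by [Cmod_Ccr_primitive] since
     [beta >= cr_primitive 1]. *)
  assert (Hne : forall z, in_disk z -> (1 + RtoC (- / beta) * Ccr_primitive z)%C <> 0).
  { intros z Hz E; assert (X := Cmod_Ccr_primitive z Hz).
    assert (E' : Ccr_primitive z = beta).
    { rewrite RtoC_opp, RtoC_inv in E by lra.
      transitivity (beta - beta * (1 + - / beta * Ccr_primitive z))%C; [field; auto|rewrite E; ring]. }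
    rewrite E', Cmod_R, Rabs_right in X; lra. }
  assert (D : forall z, in_disk z ->
    Cder (extremal_c beta) z (RtoC (/ beta) * Ccr_slope z * (extremal_c beta z * extremal_c beta z))).
  { intros z Hz; assert (Hz' := Hne z Hz).
    set (q := (1 + RtoC (- / beta) * Ccr_primitive z)%C) in *.
    apply (Cder_eq _ _ (- / (q * q) * (0 + RtoC (- / beta) * Ccr_slope z))%C).
    - unfold extremal_c; fold q; rewrite RtoC_opp, RtoC_inv by lra; field; auto.
    - apply (Cder_comp Cinv); [now apply Cder_inv|].
      apply Cder_plus; [apply Cder_const|now apply Cder_scal, Cder_Ccr_primitive]. }
  split; [|split].
  - apply analytic_Cder; eauto.
  - unfold extremal_c; rewrite Ccr_primitive_0, Cmult_0_r, Cplus_0_r.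
    field; apply C1_nz.
  - apply subordinate_of_eq; [apply analytic_phi_cr|]; intros z Hz.
    assert (Hz' := Hne z Hz).
    assert (He : extremal_c beta z <> 0).
    { unfold extremal_c; intros E; apply C1_nz; rewrite <- (Cinv_r _ Hz'), E; ring. }
    unfold Psi_c; rewrite (Cder_C_derive _ _ _ (D z Hz)), RtoC_inv by lra.
    transitivity (1 + z * Ccr_slope z)%C; [field; auto|rewrite Ccr_slope_id; ring].
Qed.

(** * Optimality of the thresholds *)

Lemma sharp_a : sharp Psi_a beta_a.
Proof.
  intros b Hb Himp; rewrite beta_a_eq in Hb; assert (HL := cr_primitive_1_pos).
  (* [b] may be negative; raising it to a positive number still below the threshold is harmless. *)
  set (beta := Rmax b (cr_primitive 1)).
  assert (H1 : b <= beta) by apply Rmax_l; assert (H2 : cr_primitive 1 <= beta) by apply Rmax_r.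
  assert (H3 : beta < 3 / 2 * cr_primitive 1) by (apply Rmax_lub_lt; lra).
  destruct (extremal_a_spec beta) as [Ha [H0 Hs]]; [lra|].
  destruct (cr_primitive_near_1 (2 / 3 * beta)) as [r [Hr HK]]; [lra|].
  apply (not_subordinate_phi_Ne (extremal_a beta) r (1 + / beta * cr_primitive r)).
  - rewrite Rabs_right; lra.
  - unfold extremal_a; now rewrite Ccr_primitive_R, RtoC_plus, RtoC_mult.
  - rewrite Rmult_comm; assert (2 / 3 <= cr_primitive r / beta) by (apply (Rle_div_r (2 / 3)); lra).
    fold (cr_primitive r / beta); lra.
  - exact (Himp _ beta Ha H0 H1 Hs).
Qed.

Lemma sharp_b : sharp Psi_b beta_b.
Proof.
  intros b Hb Himp; rewrite beta_b_eq in Hb; assert (HL := cr_primitive_1_pos).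
  assert (Hln := ln_5_3_pos).
  assert (Hq : 0 < cr_primitive 1 / ln (5 / 3)) by now apply Rdiv_lt_0_compat.
  (* Half the threshold serves only to make [beta] positive. *)
  set (beta := Rmax b (cr_primitive 1 / ln (5 / 3) / 2)).
  assert (H1 : b <= beta) by apply Rmax_l.
  assert (H2 : cr_primitive 1 / ln (5 / 3) / 2 <= beta) by apply Rmax_r.
  assert (H3 : beta < cr_primitive 1 / ln (5 / 3)) by (apply Rmax_lub_lt; lra).
  destruct (extremal_b_spec beta) as [Ha [H0 Hs]]; [lra|].
  destruct (cr_primitive_near_1 (ln (5 / 3) * beta)) as [r [Hr HK]].
  { apply Rlt_div_r in H3; lra. }
  apply (not_subordinate_phi_Ne (extremal_b beta) r (exp (/ beta * cr_primitive r))).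
  - rewrite Rabs_right; lra.
  - unfold extremal_b; now rewrite Ccr_primitive_R, <- RtoC_mult, Cexp_R.
  - rewrite <- (exp_ln (5 / 3)) by lra; left; apply exp_increasing.
    rewrite Rmult_comm; apply Rlt_div_r; lra.
  - exact (Himp _ beta Ha H0 H1 Hs).
Qed.

Lemma sharp_c : sharp Psi_c beta_c.
Proof.
  intros b Hb Himp; rewrite beta_c_eq in Hb; assert (HL := cr_primitive_1_pos).
  (* Besides excluding poles, the factor [2] gives [x <= 1/2], so that [1 - x] stays positive. *)
  set (beta := Rmax b (2 * cr_primitive 1)).
  assert (H1 : b <= beta) by apply Rmax_l; assert (H2 : 2 * cr_primitive 1 <= beta) by apply Rmax_r.
  assert (H3 : beta < 5 / 2 * cr_primitive 1) by (apply Rmax_lub_lt; lra).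
  destruct (extremal_c_spec beta) as [Ha [H0 Hs]]; [lra|].
  destruct (cr_primitive_near_1 (2 / 5 * beta)) as [r [Hr HK]]; [lra|].
  assert (Hr1 := cr_primitive_lt r 1 ltac:(lra) ltac:(lra)).
  set (x := / beta * cr_primitive r).
  assert (Hx : 2 / 5 < x <= 1 / 2).
  { unfold x; rewrite Rmult_comm; split; [apply (Rlt_div_r (2 / 5)); lra|apply (Rle_div_l _ (1 / 2)); lra]. }
  apply (not_subordinate_phi_Ne (extremal_c beta) r (/ (1 - x))).
  - rewrite Rabs_right; lra.
  - unfold extremal_c; rewrite Ccr_primitive_R, <- RtoC_mult, <- RtoC_plus, <- RtoC_inv.
    + f_equal; f_equal; unfold x; ring.
    + replace (- / beta * cr_primitive r) with (- x) by (unfold x; ring); lra.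
  - replace (5 / 3) with (/ (3 / 5)) by field; apply Rinv_le_contravar; lra.
  - exact (Himp _ beta Ha H0 H1 Hs).
Qed.

Theorem theorem3p1 :
  (forall (p : C -> C) (beta : R),
     analytic_in_disk p -> p 0 = 1 ->
     (beta_a <= beta /\ subordinate (Psi_a p beta) phi_cr) \/
     (beta_b <= beta /\ subordinate (Psi_b p beta) phi_cr) \/
     (beta_c <= beta /\ subordinate (Psi_c p beta) phi_cr) ->
     subordinate p phi_Ne)
  /\ sharp Psi_a beta_a /\ sharp Psi_b beta_b /\ sharp Psi_c beta_c.
Proof.
  split; [|split; [|split]].
  - intros p beta Hp Hp0 [[Hb Hs]|[[Hb Hs]|[Hb Hs]]].
    + now apply (phi_cr_implies_phi_Ne_a p beta).
    + now apply (phi_cr_implies_phi_Ne_b p beta).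
    + now apply (phi_cr_implies_phi_Ne_c p beta).
  - exact sharp_a.
  - exact sharp_b.
  - exact sharp_c.
Qed.
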